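(* Let $\Gamma$ be an infinite spherically symmetric tree whose growth function $f : \{1,2,3,\ldots\} \to \{1,2,3,\ldots\}$ is nondecreasing, and let $\{X(v)\}$ be independent exponential random variables of mean $1$ indexed by the vertices of $\Gamma$. Then the probability of an explosion is zero or one according to whether $\sum_{n=1}^\infty f(n)^{-1}$ is infinite or finite. Furthermore, if the sum is infinite and $f$ is unbounded as well, then $$\frac{M_N}{\sum_{n=1}^N f(n)^{-1}} \longrightarrow e^{-1} \quad \text{almost surely as } N \to \infty.$$
   Context: $\Gamma$ is a tree with root $\rho$; $|v|$ is the distance from $\rho$ to $v$, and $w \leq v$ means $w$ lies on the path from $\rho$ to $v$. $\Gamma$ is spherically symmetric with growth function $f$ if every vertex $v$ has exactly $f(|v|+1)$ children (neighbors farther from the root); that is, each vertex at distance $n-1$ from the root has $f(n)$ children. First-passage percolation: $X(v)$ is the transit time across the edge connecting $v$ to its parent, and $$S(v) = \sum_{\rho < w \leq v} X(w), \qquad M_n = \min_{|v| = n} S(v),$$ where the sum is over all vertices $w \neq \rho$ on the path from $\rho$ to $v$ (including $v$). An explosion is the event that the increasing sequence $(M_n)$ is bounded. *)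

(* Defs.v *)
(* MathComp-Analysis *)
From mathcomp Require Export all_boot all_order all_algebra.
From mathcomp Require Export all_classical all_reals all_analysis.
Export Order.TTheory GRing.Theory Num.Theory.
Export numFieldNormedType.Exports.

Set Implicit Arguments.
Unset Strict Implicit.
Unset Printing Implicit Defensive.

Local Open Scope classical_set_scope.
Local Open Scope card_scope.
Local Open Scope ring_scope.

(* As everywhere in [path.v], a walk [x :: p] is given by its start [x] and the
   list [p] of the vertices that follow; its length in edges is [size p]. *)
Definition is_walk (V : choiceType) (e : rel V) (x y : V) (p : seq V) : Prop :=
  path e x p /\ last x p = y.

Definition is_simple_path (V : choiceType) (e : rel V) (x y : V) (p : seq V)
  : Prop := is_walk e x y p /\ uniq (x :: p).

Definition is_tree (V : choiceType) (e : rel V) : Prop :=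
  [/\ symmetric e, irreflexive e
    & forall x y, exists! p, is_simple_path e x y p].

(* The default values of [xget] are irrelevant in a tree. *)
Definition dist (V : choiceType) (e : rel V) (x y : V) : nat :=
  xget 0%N [set n | (exists p, is_walk e x y p /\ size p = n) /\
                    (forall p, is_walk e x y p -> (n <= size p)%N)].

(* The starting vertex [x] is not listed. *)
Definition tree_path (V : choiceType) (e : rel V) (x y : V) : seq V :=
  xget [::] [set p | is_simple_path e x y p].

Definition children (V : choiceType) (e : rel V) (rho v : V) : set V :=
  [set w | e v w /\ (dist e rho v < dist e rho w)%N].

Definition spherically_symmetric (V : choiceType) (e : rel V) (rho : V)
    (f : nat -> nat) : Prop :=
  forall v, children e rho v #= `I_(f (dist e rho v).+1).

Definition mutually_independent (d : measure_display) (T : measurableType d)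
    (R : realType) (P : probability T R) (I : choiceType)
    (X : I -> {RV P >-> R}) : Prop :=
  forall (s : seq I) (A : I -> set R),
    uniq s -> (forall i, measurable (A i)) ->
    P (\big[setI/setT]_(i <- s) (X i @^-1` A i)) =
    (\prod_(i <- s) P (X i @^-1` A i))%E.

(* The parameter of [exponential_prob] is the rate, i.e. the inverse mean. *)
Definition exponential_mean1 (d : measure_display) (T : measurableType d)
    (R : realType) (P : probability T R) (Y : {RV P >-> R}) : Prop :=
  forall A : set R, measurable A -> distribution P Y A = exponential_prob 1 A.

(* [tree_path e rho v] lists exactly the [w] with [rho < w <= v]. *)
Definition passage_time (V : choiceType) (e : rel V) (rho : V) (T : Type)
    (R : realType) (X : V -> T -> R) (v : V) (t : T) : R :=
  \sum_(w <- tree_path e rho v) X w t.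

(* [inf] is a minimum here: in a spherically symmetric tree with positive growth
   function the vertices at distance [n] form a finite nonempty set. *)
Definition min_passage_time (V : choiceType) (e : rel V) (rho : V) (T : Type)
    (R : realType) (X : V -> T -> R) (n : nat) (t : T) : R :=
  inf [set passage_time e rho X v t | v in [set v | dist e rho v = n]].

Definition explosion (V : choiceType) (e : rel V) (rho : V) (T : Type)
    (R : realType) (X : V -> T -> R) : set T :=
  [set t | bounded_fun (fun n => min_passage_time e rho X n t)].

(* Main.v *)
Require Import Defs.
From mathcomp Require Import all_boot all_order all_algebra.
From mathcomp Require Import all_classical all_reals all_analysis.
From mathcomp Require Import measurable_realfun.
From mathcomp Require Import zify ring lra.
Import Order.TTheory GRing.Theory Num.Theory.
Import numFieldNormedType.Exports.

(* Write H_N for the sum of 1/f(n) over n <= N and v_k for the ancestor of v at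
   distance k from the root.

   Lower bound. Put lam_k = e f(k). By Chernoff and a union bound, the
   probability that some vertex v at level n has
   sum_k lam_k X(v_k) < (1 - eps) n is at most exp(- eps n / 2), so by
   Borel-Cantelli this fails for all large n. As 1/lam_k is nonincreasing, Abel
   summation turns this control of all the weighted partial sums into
   S(v) >= (1 - eps) H_n / e - A. (A first moment bound with the unweighted sums
   S(v) would lose the ratio of the arithmetic to the geometric mean of 1/f.)

   Upper bound, f unbounded. From a level n0 on, cut each edge weight at level k
   into cells of probability exactly beta / f(k), and call a block of L
   consecutive edges good when its cell indices have a small sum. For every
   c > 1/e one can choose L and beta so that a block has cost about
   c L / f(level) while the mean number of good continuations of a vertex
   exceeds 1. The second moment method, started from all the vertices of level
   n0 at once, yields good lines of descent of every length outside an event of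
   probability O(1 / (f(1) ... f(n0))), which tends to 0; hence
   M_N <= c H_N + A almost surely and no zero-one law is needed. *)

Set Implicit Arguments.
Unset Strict Implicit.
Unset Printing Implicit Defensive.

Local Open Scope classical_set_scope.
Local Open Scope ring_scope.

(** * Words and the Ulam-Harris encoding *)

Section words.
Local Open Scope nat_scope.

(** Ulam-Harris names: letter [k] picks one of the [F k] children of a vertex at level [k], so the
    tree itself uses [F := f \o S]. With constant [F] the same words also enumerate cell indices and
    block codes. *)
Fixpoint words (F : nat -> nat) (n : nat) : seq (seq nat) :=
  if n is m.+1 then [seq rcons w j | w <- words F m, j <- iota 0 (F m)]
  else [:: [::]].

Lemma words_rcons F n w j :
  (rcons w j \in words F n.+1) = (w \in words F n) && (j < F n).
Proof.
apply/allpairsP/idP => [[[w' j'] /= [w'F]]|/andP[wF jF]].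
  by rewrite mem_iota add0n => /= jF /rcons_inj[-> ->]; rewrite w'F jF.
by exists (w, j); rewrite mem_iota.
Qed.

Lemma wordsP F n w :
  reflect (size w = n /\ forall k, k < n -> nth 0 w k < F k) (w \in words F n).
Proof.
elim: n w => [|n IH] w.
  rewrite inE; apply: (iffP eqP) => [->//|[/size0nil]//].
case: (lastP w) => [|{}w j].
  apply: (iffP idP) => [|[]//].
  by move=> /allpairsP[[w' j'] /= [_ _]] /(congr1 size); rewrite size_rcons.
rewrite words_rcons size_rcons; apply: (iffP andP).
  move=> [/IH[sw wF] jF]; split; rewrite ?sw// => k.
  rewrite ltnS leq_eqVlt nth_rcons sw => /orP[/eqP->|kn].
    by rewrite ltnn eqxx.
  by rewrite kn wF.
move=> [[sw] wF]; split.
  apply/IH; split => // k kn; have := wF k (ltnW kn).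
  by rewrite nth_rcons sw kn.
by have := wF n (ltnSn _); rewrite nth_rcons sw ltnn eqxx.
Qed.

Lemma size_words_mem F n w : w \in words F n -> size w = n.
Proof. by case/wordsP. Qed.

Lemma words_uniq F n : uniq (words F n).
Proof.
elim: n => //= n IH; apply: allpairs_uniq; rewrite ?iota_uniq//.
by move=> [w j] [w' j'] _ _ /= /rcons_inj[-> ->].
Qed.

Lemma size_words F n : size (words F n) = \prod_(0 <= k < n) F k.
Proof.
elim: n => [|n IH]; first by rewrite big_geq.
by rewrite /= size_allpairs size_iota big_nat_recr//= IH.
Qed.

Lemma take_words F n m w : m <= n -> w \in words F n -> take m w \in words F m.
Proof.
move=> mn /wordsP[sw wF]; apply/wordsP; split; first by rewrite size_takel ?sw.
by move=> k km; rewrite nth_take// wF// (leq_trans km).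
Qed.

(** All vertices of level [m] have equally many descendants at level [n]; this evaluates the sums
    over pairs in the second moment. *)
Lemma count_words_take F m p n : m <= n -> p \in words F m ->
  count (fun w => take m w == p) (words F n) = \prod_(m <= k < n) F k.
Proof.
move=> mn pm; elim: n mn => [|n IH].
  by rewrite leqn0 => /eqP m0; move: pm; rewrite m0 big_geq// inE => /eqP ->.
rewrite leq_eqVlt => /orP[/eqP mn|mn].
  rewrite big_geq ?mn// -mn (@eq_in_count _ _ (pred1 p)).
    by rewrite count_uniq_mem ?words_uniq// pm.
  by move=> w wm /=; rewrite take_oversize// (size_words_mem wm).
rewrite big_nat_recr//= -IH// count_flatten sumnE.
rewrite -map_comp big_map.
transitivity (\sum_(w <- words F n) (take m w == p) * F n); last first.
  by rewrite -big_distrl/= -sumn_count sumnE big_map.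
apply: eq_big_seq => w wn /=; rewrite count_map.
rewrite (@eq_count _ _ (fun=> take m w == p)).
  case: eqP => _; last by rewrite count_pred0.
  by rewrite count_predT size_iota mul1n.
by move=> j /=; rewrite -cats1 takel_cat// (size_words_mem wn) -ltnS.
Qed.

Lemma words_neq0 F n : (forall k, 0 < F k) -> words F n != [::].
Proof.
move=> F0; rewrite -size_eq0 size_words -lt0n; apply: prodn_cond_gt0 => //.
Qed.

End words.

(** * Paths in a tree and the coding of its vertices by words *)

Section tree.
Variables (V : choiceType) (e : rel V).
Hypothesis tree_e : is_tree e.

Lemma tree_pathP x y : is_simple_path e x y (tree_path e x y).
Proof.
have [_ _ /(_ x y)[p [xyp _]]] := tree_e.
by rewrite /tree_path; case: xgetP => [q _ //|/(_ p)].
Qed.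

Lemma tree_path_unique x y p : is_simple_path e x y p -> tree_path e x y = p.
Proof.
move=> xyp; have [_ _ /(_ x y)[q [_ qP]]] := tree_e.
by rewrite -(qP _ xyp) -(qP _ (tree_pathP x y)).
Qed.

(** Every walk shortens to a simple path through some of its vertices, and by uniqueness that path
    is [tree_path]; hence no walk is shorter. *)
Lemma dist_tree x y : dist e x y = size (tree_path e x y).
Proof.
have [[xp lp] up] := tree_pathP x y.
set S := [set n | (exists p, is_walk e x y p /\ size p = n) /\
                    (forall p, is_walk e x y p -> (n <= size p)%N)].
have Sp : S (size (tree_path e x y)).
  split; first by exists (tree_path e x y).
  move=> q [xq lq].
  case/shortenP: xq lq => q' xq' uq' sub lq'.
  have -> : tree_path e x y = q' by apply: tree_path_unique.
  by apply: uniq_leq_size => //; case/andP: uq'.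
rewrite /dist -/S; case: xgetP => [m -> [[p [xyp <-]] mP]|/(_ _ Sp)//].
apply/eqP; rewrite eqn_leq; apply/andP; split; last by apply Sp.2.
by apply: mP.
Qed.

Variable rho : V.

(** If [w] already lay on the path to [v], the path to [w] would be an initial segment of it, and
    [w] would not be farther from the root than [v]. *)
Lemma tree_path_child v w : children e rho v w ->
  tree_path e rho w = rcons (tree_path e rho v) w.
Proof.
move=> [evw]; rewrite !dist_tree => vw; apply: tree_path_unique.
have [[pv lv] uv] := tree_pathP rho v.
split; first by rewrite /is_walk rcons_path last_rcons pv lv.
rewrite -rcons_cons rcons_uniq uv andbT; apply/negP; rewrite inE.
case/orP => [/eqP wr|wp].
  by move: vw; rewrite (@tree_path_unique rho w [::]) // wr; split.
case/splitPr: wp pv lv uv vw => p1 p2 pv lv uv.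
rewrite (@tree_path_unique rho w (rcons p1 w)); last first.
  split; last by move: uv; rewrite -cat_rcons -cat_cons cat_uniq => /andP[].
  by split; [move: pv; rewrite -cat_rcons cat_path => /andP[]|rewrite last_rcons].
by rewrite size_rcons size_cat/= addnS ltnS ltnNge leq_addr.
Qed.

Lemma dist_child v w : children e rho v w -> dist e rho w = (dist e rho v).+1.
Proof. by move=> vw; rewrite !dist_tree (tree_path_child vw) size_rcons. Qed.

Lemma parentP v n : dist e rho v = n.+1 ->
  exists2 u, dist e rho u = n & children e rho u v.
Proof.
rewrite dist_tree => sv; have [[]] := tree_pathP rho v.
case/lastP def_p: (tree_path e rho v) sv => [//|p x].
rewrite size_rcons last_rcons rcons_path => -[sp] /andP[pp ex] xv.
rewrite -rcons_cons rcons_uniq => /andP[_ up]; rewrite -{}xv in def_p *.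
have lp : tree_path e rho (last rho p) = p by exact: tree_path_unique.
exists (last rho p); first by rewrite dist_tree lp.
by split => //; rewrite !dist_tree lp def_p size_rcons.
Qed.

(** The children of each vertex are numbered once and for all, and [vert] follows the letters of a
    word down from the root. The ancestors of [vert s] are then the images of the nonempty prefixes
    of [s]. *)
Lemma ulam_harris (f : nat -> nat) : spherically_symmetric e rho f ->
  exists vert : seq nat -> V, [/\
    forall n s, s \in words (f \o S) n -> dist e rho (vert s) = n /\
      tree_path e rho (vert s) = mkseq (fun k => vert (take k.+1 s)) n,
    forall n s s', s \in words (f \o S) n -> s' \in words (f \o S) n ->
      vert s = vert s' -> s = s' &
    forall n v, dist e rho v = n ->
      exists2 s, s \in words (f \o S) n & vert s = v].
Proof.
move=> symm_e.
have /choice[idx idx_bij] v : exists g, set_bij (children e rho v) `I_(f (dist e rho v).+1) g.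
  exact/card_set_bijP/symm_e.
(* The default [rho] is only returned for [j] beyond the number of children, which no letter of a
   valid word reaches. *)
pose child v j := xget rho [set w | children e rho v w /\ idx v w = j].
have childP v j : (j < f (dist e rho v).+1)%N ->
    children e rho v (child v j) /\ idx v (child v j) = j.
  move=> jf; rewrite /child; case: xgetP => [w -> []//|none].
  have [_ _ /(_ j jf)[w cw wj]] := idx_bij v.
  by have := none w (conj cw wj).
have idxP v w : children e rho v w -> (idx v w < f (dist e rho v).+1)%N.
  by have [sub _ _] := idx_bij v => /sub.
have idxK v w : children e rho v w -> child v (idx v w) = w.
  move=> cw; have [cv iw] := childP _ _ (idxP _ _ cw).
  by have [_ inj _] := idx_bij v; apply: inj; rewrite ?inE.
pose vert s := foldl child rho s.
have vert_rcons s j : vert (rcons s j) = child (vert s) j.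
  by rewrite /vert foldl_rcons.
have vertP n s : s \in words (f \o S) n -> dist e rho (vert s) = n /\
      tree_path e rho (vert s) = mkseq (fun k => vert (take k.+1 s)) n.
  elim: n s => [|n IH] s.
    rewrite inE => /eqP ->; rewrite /vert /= /mkseq /= dist_tree.
    by rewrite (@tree_path_unique rho rho [::])//; split.
  case: (lastP s) => [/size_words_mem//|{}s j].
  rewrite words_rcons => /andP[sn jf]; have [ds ps] := IH _ sn.
  rewrite vert_rcons; have [|cj _] := childP (vert s) j; first by rewrite ds.
  split; first by rewrite (dist_child cj) ds.
  rewrite (tree_path_child cj) ps mkseqS take_oversize ?size_rcons ?(size_words_mem sn)//.
  rewrite vert_rcons; congr rcons; apply/eq_in_map => k; rewrite mem_iota /= => kn.
  by rewrite -cats1 takel_cat// (size_words_mem sn).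
exists vert; split => //.
- elim=> [|n IH] s s'; first by rewrite !inE => /eqP -> /eqP ->.
  case: (lastP s) => [/size_words_mem//|{}s j].
  case: (lastP s') => [_ /size_words_mem//|{}s' j'].
  rewrite !words_rcons !vert_rcons => /andP[sn jf] /andP[sn' jf'] eqv.
  have [ds ps] := vertP _ _ sn; have [ds' ps'] := vertP _ _ sn'.
  have [|cj ij] := childP (vert s) j; first by rewrite ds.
  have [|cj' ij'] := childP (vert s') j'; first by rewrite ds'.
  (* The parent is recovered as the end of the path with its last vertex removed. *)
  have ss' : vert s = vert s'.
    have := tree_path_child cj; rewrite eqv (tree_path_child cj').
    move=> /rcons_inj[pp]; have [[_ ls] _] := tree_pathP rho (vert s).
    have [[_ ls'] _] := tree_pathP rho (vert s').
    by rewrite -[LHS]ls -[RHS]ls' pp.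
  by rewrite -ij -ij' eqv ss' (IH _ _ sn sn').
- elim=> [|n IH] v dv.
    exists [::]; rewrite ?inE//; move: dv; rewrite dist_tree => /size0nil pv.
    by have [[_ <-] _] := tree_pathP rho v; rewrite pv.
  have [u du cu] := parentP dv; have [s sn us] := IH _ du.
  exists (rcons s (idx u v)); last by rewrite vert_rcons us idxK.
  by rewrite words_rcons sn /= -du idxP.
Qed.

End tree.

(** * The second moment method *)

Section finite_families.
Context d (T : measurableType d) (R : realType) (P : probability T R).

Lemma probability_bigsetU_le (I : Type) (s : seq I) (E : I -> set T) :
  (forall i, measurable (E i)) ->
  (P (\big[setU/set0]_(i <- s) E i) <= \sum_(i <- s) P (E i))%E.
Proof.
move=> mE; elim: s => [|i s IH]; first by rewrite !big_nil measure0.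
rewrite !big_cons (le_trans (measureU2 _ _ _))//.
  exact: bigsetU_measurable.
by rewrite leeD2l.
Qed.

(** Chebyshev's inequality for the number [Z] of events that occur: its mean is [a], its variance at
    most [v]. Multiplying out avoids a division by [a], which may vanish. *)
Lemma second_moment (I : choiceType) (s : seq I) (E : I -> set T) (p v : R) :
  (forall i, measurable (E i)) -> {in s, forall i, P (E i) = p%:E} ->
  (\sum_(i <- s) \sum_(j <- s) P (E i `&` E j)
    <= (((size s)%:R * p) ^+ 2 + v)%:E)%E ->
  (P (~` \big[setU/set0]_(i <- s) E i) * (((size s)%:R * p) ^+ 2)%:E <= v%:E)%E.
Proof.
move=> mE Ep; set a := _ * p => EE.
pose Z t : R := \sum_(i <- s) \1_(E i) t.
set N := ~` _.
have mU : measurable (\big[setU/set0]_(i <- s) E i) by exact: bigsetU_measurable.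
have mN : measurable N by exact: measurableC.
have p0 i : i \in s -> 0 <= p.
  by move=> iS; rewrite -lee_fin -(Ep _ iS).
have a0 : 0 <= a.
  rewrite /a; case: (s) p0 => [_|i s' /(_ i)]; first by rewrite mul0r.
  by rewrite inE eqxx => /(_ isT) p0; rewrite mulr_ge0.
have Zge0 t : 0 <= Z t by exact: sumr_ge0.
have Z0 t : N t -> Z t = 0.
  move=> Nt; rewrite /Z big_seq big1// => i iS.
  rewrite indicE memNset// => Et; apply: Nt.
  by rewrite -bigcup_seq; exists i.
have IE i : (\int[P]_t (\1_(E i) t)%:E = P (E i))%E.
  by rewrite integral_indic// setIT.
have intZ : (\int[P]_t (Z t)%:E = a%:E)%E.
  under eq_integral do rewrite /Z -sumEFin.
  rewrite ge0_integral_sum//=; last first.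
    by move=> i; apply/measurable_EFinP; exact: measurable_indic.
  rewrite (@eq_big_seq _ _ _ _ _ _ (fun=> p%:E))/=; last by move=> i iS; rewrite IE Ep.
  rewrite sumEFin big_const_seq count_predT iter_addr_0.
  by rewrite /a mulr_natl.
have intZ2 : (\int[P]_t (Z t ^+ 2)%:E =
    \sum_(i <- s) \sum_(j <- s) P (E i `&` E j))%E.
  under eq_integral do rewrite expr2 /Z mulr_suml -sumEFin.
  have mij i j : measurable_fun setT (fun t => (\1_(E i) t * \1_(E j) t)%:E : \bar R).
    by apply/measurable_EFinP; apply: measurable_funM; exact: measurable_indic.
  rewrite ge0_integral_sum//=; last 2 first.
  - move=> i; apply/measurable_EFinP; apply: measurable_funM.
      exact: measurable_indic.
    by apply: measurable_sum => j; exact: measurable_indic.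
  - by move=> i t _; rewrite lee_fin mulr_ge0// sumr_ge0.
  apply: eq_bigr => i _; under eq_integral do rewrite mulr_sumr -sumEFin.
  rewrite ge0_integral_sum//=.
  apply: eq_bigr => j _.
  rewrite -[E i `&` E j]setIT -integral_indic//; last exact: measurableI.
  by apply: eq_integral => t _; rewrite indicI.
have mZ : measurable_fun setT Z.
  by apply: measurable_sum => j; exact: measurable_indic.
clearbody a.
(* This is [a ^+ 2 * \1_N <= (Z - a) ^+ 2] rearranged so that both sides are sums of nonnegative
   terms and can be integrated termwise. *)
have : (\int[P]_t (2 * a * Z t + a ^+ 2 * \1_N t)%:E <=
        \int[P]_t (Z t ^+ 2 + a ^+ 2)%:E)%E.
  apply: ge0_le_integral => //=.
  - move=> t _; rewrite lee_fin addr_ge0// !mulr_ge0// ?sqr_ge0//.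
  - apply/measurable_EFinP; apply: measurable_funD; apply: measurable_funM => //.
  - by apply/measurable_EFinP; apply: measurable_funD => //; exact: measurable_funX.
  - move=> t _; rewrite lee_fin indicE; case: (asboolP (N t)) => Nt.
      by rewrite mem_set// Z0//= mulr0 mulr1 expr0n/= !add0r.
    rewrite memNset// mulr0 addr0 -subr_ge0.
    by rewrite (_ : _ - _ = (Z t - a) ^+ 2) ?sqr_ge0//; ring.
rewrite (_ : (\int[P]_t (2 * a * Z t + a ^+ 2 * \1_N t)%:E =
  (2 * a)%:E * a%:E + (a ^+ 2)%:E * P N)%E); last first.
  under eq_integral do rewrite EFinD.
  rewrite ge0_integralD//=; last 4 first.
  - by move=> t _; rewrite lee_fin !mulr_ge0.
  - by apply/measurable_EFinP; apply: measurable_funM.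
  - by move=> t _; rewrite lee_fin !mulr_ge0// sqr_ge0.
  - by apply/measurable_EFinP; apply: measurable_funM.
  under eq_integral do rewrite EFinM.
  rewrite ge0_integralZl//=; last 3 first.
  - by apply/measurable_EFinP.
  - by move=> t _; rewrite lee_fin.
  - by rewrite lee_fin mulr_ge0.
  rewrite intZ; congr (_ + _)%E.
  under eq_integral do rewrite EFinM.
  rewrite ge0_integralZl//=; last 2 first.
  - by apply/measurable_EFinP.
  - by rewrite lee_fin sqr_ge0.
  by rewrite integral_indic// setIT.
under [in leRHS]eq_integral do rewrite EFinD.
rewrite ge0_integralD//=; last 3 first.
- by move=> t _; rewrite lee_fin sqr_ge0.
- by apply/measurable_EFinP; exact: measurable_funX.
- by move=> t _; rewrite lee_fin sqr_ge0.
rewrite intZ2 integral_cst//= [P setT]probability_setT mule1 => le1.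
have /le_trans/(_ (leeD EE (lexx _))) := le1.
rewrite -(fineK (fin_num_measure P _ mN)) -!EFinM -!EFinD !lee_fin => H.
by nra.
Qed.
End finite_families.

(** * Independent exponential edge weights *)

Section exponential.
Context d (T : measurableType d) (R : realType) (P : probability T R).
Variable Y : {RV P >-> R}.
Hypothesis expY : exponential_mean1 Y.

Lemma preimage_measurable (A : set R) : measurable A -> measurable (Y @^-1` A).
Proof. by move=> mA; rewrite -[_ @^-1` _]setTI; exact: measurable_funP. Qed.

Lemma exponential_le0 : P (Y @^-1` `]-oo, 0]) = 0%E.
Proof.
have -> : P (Y @^-1` `]-oo, 0]) = exponential_prob 1 (`]-oo, 0] : set R).
  exact: expY.
rewrite -(@setUitv1 _ _ -oo%O 0 true)// /exponential_prob ge0_integral_setU//=.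
- rewrite integral_set1 adde0 integral0_eq//= => x.
  by rewrite in_itv/= => x0; rewrite lt0_exponential_pdf.
- apply/measurable_EFinP; apply: measurable_funS (measurable_exponential_pdf _) => //.
- by move=> x _; rewrite lee_fin exponential_pdf_ge0.
- apply/disj_setPS => x [/=] /[swap] ->.
  by rewrite in_itv/= ltxx.
Qed.

Lemma exponential_itv0c (b : R) : 0 <= b ->
  P (Y @^-1` `[0, b]) = (1 - expR (- b))%:E.
Proof.
move=> b0; have -> : P (Y @^-1` `[0, b]) = exponential_prob 1 (`[0, b] : set R).
  exact: expY.
move: b0; rewrite le_eqVlt => /orP[/eqP <-|b0].
  by rewrite oppr0 expR0 subrr set_itv1 /exponential_prob integral_set1.
by rewrite exponential_prob_itv0c// mulN1r EFinB.
Qed.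

Lemma exponential_itv (a b : R) : 0 <= a -> a <= b ->
  P (Y @^-1` `]a, b]) = (expR (- a) - expR (- b))%:E.
Proof.
move=> a0 ab.
have -> : Y @^-1` `]a, b] = (Y @^-1` `[0, b]) `\` (Y @^-1` `[0, a]).
  apply/seteqP; split => t /=; rewrite !in_itv/=.
    move=> /andP[aY Yb]; rewrite Yb (le_trans a0 (ltW aY)); split => //.
    by rewrite /= leNgt aY.
  by move=> [/andP[Y0 ->]]; rewrite Y0 /= andbT ltNge => /negP.
rewrite measureD//; last 3 first.
- exact: preimage_measurable.
- exact: preimage_measurable.
- by rewrite ltey_eq fin_num_measure//; exact: preimage_measurable.
rewrite setIidr; last first.
  move=> t /=; rewrite !in_itv/= => /andP[-> /le_trans]; exact.
transitivity ((1 - expR (- b))%:E - (1 - expR (- a))%:E)%E.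
  by congr (_ - _)%E; apply: exponential_itv0c => //; exact: le_trans ab.
by rewrite -EFinB; congr EFin; ring.
Qed.

End exponential.

Lemma ceil_nat (R : realType) (y : R) : 0 < y ->
  exists a : nat, a%:R < y <= a.+1%:R.
Proof.
move=> y0; have /andP[] := ceil_itv y.
have : 0 < Num.ceil y by rewrite ceil_gt0.
case: (Num.ceil y) => // -[//|a] _.
rewrite rmorphB /= -pmulrn -{1}natr1 addrK => ya yb.
by exists a; rewrite ya.
Qed.

Lemma sum_words_expr (R : comPzRingType) (x : R) q n :
  \sum_(a <- words (fun=> q) n) x ^+ sumn a = (\sum_(0 <= j < q) x ^+ j) ^+ n.
Proof.
elim: n => [|n IH]; first by rewrite big_seq1.
rewrite /= big_allpairs_dep exprSr -IH mulr_suml; apply: eq_bigr => a _.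
rewrite mulr_sumr /index_iota subn0; apply: eq_bigr => j _.
by rewrite sumn_rcons exprD.
Qed.

(** * Events along one line of descent and a Chernoff bound *)

Section independent_words.
Context d (T : measurableType d) (R : realType) (P : probability T R).
Variables (F : nat -> nat) (Y : seq nat -> {RV P >-> R}).

Definition independent_words := forall (ss : seq (seq nat)) (A : seq nat -> set R),
  uniq ss -> {in ss, forall s, s \in words F (size s)} ->
  (forall s, measurable (A s)) ->
  P (\big[setI/setT]_(s <- ss) (Y s @^-1` A s)) =
  (\prod_(s <- ss) P (Y s @^-1` A s))%E.

Hypothesis indepY : independent_words.
Hypothesis expY : forall s, exponential_mean1 (Y s).

(** Index [k] stands for the edge from level [k] to level [k + 1], whose lower end is the prefix
    [take k.+1 w]. *)
Definition path_event (w : seq nat) m n (A : nat -> set R) : set T :=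
  \big[setI/setT]_(m <= k < n) (Y (take k.+1 w) @^-1` A k).

Lemma measurable_path_event w m n A : (forall k, measurable (A k)) ->
  measurable (path_event w m n A).
Proof. by move=> mA; apply: bigsetI_measurable => k _; exact: preimage_measurable. Qed.

Lemma path_eventP w m n A t :
  path_event w m n A t <-> forall k, (m <= k < n)%N -> A k (Y (take k.+1 w) t).
Proof.
rewrite /path_event -bigcap_seq; split => [+ k kmn|H k /=].
  by move=> /(_ k); rewrite /= mem_index_iota => /(_ kmn).
by rewrite mem_index_iota; apply: H.
Qed.

Lemma probability_path_event w m n A (p : nat -> R) : w \in words F n ->
  (forall k, measurable (A k)) ->
  (forall k s, (m <= k < n)%N -> P (Y s @^-1` A k) = (p k)%:E) ->
  P (path_event w m n A) = (\prod_(m <= k < n) p k)%:E.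
Proof.
move=> wF mA Ap; have sw := size_words_mem wF.
have st k : (k < n)%N -> size (take k.+1 w) = k.+1 by move=> kn; rewrite size_takel ?sw.
have -> : path_event w m n A =
    \big[setI/setT]_(s <- [seq take k.+1 w | k <- index_iota m n])
      (Y s @^-1` A (size s).-1).
  by rewrite big_map; apply: eq_big_nat => k /andP[_ kn]; rewrite st.
rewrite indepY//.
- rewrite big_map -prodEFin big_seq [RHS]big_seq; apply: eq_bigr => k.
  by rewrite mem_index_iota => kmn; rewrite st ?Ap//; case/andP: kmn.
- rewrite map_inj_in_uniq ?iota_uniq// => k l.
  rewrite !mem_index_iota => /andP[_ kn] /andP[_ ln] /(congr1 size).
  by rewrite !st// => -[].
- move=> s /mapP[k]; rewrite mem_index_iota => /andP[_ kn] ->.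
  by rewrite st// (@take_words F n).
Qed.

(** A discretised Chernoff bound that needs only independence of events. [D] is the union, over
    integer vectors [a] with [eta * sumn a <= s], of the events that [lam k * Y] lies in the
    [a k]-th interval of length [eta] for every [k]. The discretisation costs a factor
    [eta / (1 - expR (- eta)) <= expR eta] per edge. *)
Lemma chernoff w n (lam : nat -> R) (s eta : R) : w \in words F n ->
  (forall k, 0 < lam k) -> 0 <= s -> 0 < eta ->
  exists2 D : set T, measurable D /\
    (P D <= (expR (s + eta * n%:R) / \prod_(0 <= k < n) lam k)%:E)%E &
    forall t, (forall k, (k < n)%N -> 0 < Y (take k.+1 w) t) ->
      \sum_(0 <= k < n) lam k * Y (take k.+1 w) t < s -> D t.
Proof.
move=> wF lam0 s0 eta0.
pose Q := Num.truncn (s / eta).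
pose A (a : seq nat) k : set R :=
  `](nth 0%N a k)%:R * (eta / lam k), (nth 0%N a k).+1%:R * (eta / lam k)]%classic.
have mA a k : measurable (A a k) by exact: measurable_itv.
have el0 k : 0 < eta / lam k by rewrite divr_gt0.
pose as_ := [seq a <- words (fun=> Q.+1) n | (sumn a <= Q)%N].
exists (\big[setU/set0]_(a <- as_) path_event w 0 n (A a)); last first.
  move=> t Y0 Ys.
  have /choice[a aP] k : exists a : nat, (k < n)%N ->
      a%:R < Y (take k.+1 w) t / (eta / lam k) <= a.+1%:R.
    case: (ltnP k n) => [kn|_]; last by exists 0%N.
    by have [|a aP] := @ceil_nat _ (Y (take k.+1 w) t / (eta / lam k));
      [rewrite divr_gt0 ?Y0|exists a].
  have sumQ : (sumn (mkseq a n) <= Q)%N.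
    rewrite truncn_ge_nat ?divr_ge0 ?(ltW eta0)// ler_pdivlMr//.
    rewrite sumnE big_map natr_sum mulr_suml ltW//.
    apply: le_lt_trans Ys.
    rewrite /index_iota subn0 big_seq [leRHS]big_seq; apply: ler_sum => k.
    rewrite mem_iota add0n => kn; have /andP[+ _] := aP _ kn.
    rewrite ltr_pdivlMr// mulrA ltr_pdivrMr// => /ltW.
    by rewrite [_ * lam k]mulrC.
  rewrite -bigcup_seq; exists (mkseq a n) => /=.
    rewrite mem_filter sumQ; apply/wordsP; split; first by rewrite size_mkseq.
    move=> k kn; rewrite nth_mkseq// ltnS (leq_trans _ sumQ)//.
    rewrite sumnE big_map (bigD1_seq k) ?iota_uniq ?mem_iota//=.
    by rewrite leq_addr.
  apply/path_eventP => k /= kn; rewrite /A /= in_itv/= nth_mkseq//.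
  have /andP[al ar] := aP _ kn.
  by move: al ar; rewrite ltr_pdivlMr// ler_pdivrMr// => -> ->.
split.
  by apply: bigsetU_measurable => a _; exact: measurable_path_event.
(* The exponential density is at most 1, so an interval has probability at most its length
   [eta / lam k]. *)
have Pa a : (P (path_event w 0 n (A a)) <= (\prod_(0 <= k < n) (eta / lam k))%:E)%E.
  pose p k := expR (- ((nth 0%N a k)%:R * (eta / lam k))) -
              expR (- ((nth 0%N a k).+1%:R * (eta / lam k))).
  rewrite (@probability_path_event _ _ _ _ p)//; last first.
    move=> k u _; rewrite exponential_itv//.
      by rewrite mulr_ge0// ltW.
    by rewrite ler_wpM2r ?ler_nat// ltW.
  rewrite lee_fin; apply: ler_prod => k _; apply/andP; split.
    by rewrite subr_ge0 ler_expR lerN2 ler_wpM2r ?ler_nat// ltW.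
  rewrite /p -natr1 mulrDl mul1r opprD expRD.
  set x := expR (- (_ * _)); rewrite -{1}[x]mulr1 -mulrBr -[leRHS]mul1r.
  have := expR_ge1Dx (- (eta / lam k)) => e1.
  apply: ler_pM; first exact: expR_ge0.
  - by rewrite subr_ge0 -expR0 ler_expR oppr_le0 ltW.
  - by rewrite /x -expR0 ler_expR oppr_le0 mulr_ge0// ltW.
  - by rewrite lerBlDr addrC -lerBlDr.
apply: (le_trans (probability_bigsetU_le _ _ _)).
  by move=> a; exact: measurable_path_event.
apply: (le_trans (lee_sum _ (fun a _ => Pa a))).
rewrite sumEFin lee_fin.
set q := expR (- eta).
have q1 : q < 1 by rewrite expR_lt1 oppr_lt0.
have q0 : 0 < q by exact: expR_gt0.
set p := \prod_(_ <= k < _) (eta / _).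
have p0 : 0 <= p by apply: prodr_ge0 => k _; exact: ltW.
apply: (@le_trans _ _ (p * expR s * (1 - q)^-1 ^+ n)).
  apply: (@le_trans _ _ (\sum_(a <- as_) p * expR s * q ^+ sumn a)).
    rewrite !big_filter; apply: ler_sum => a aQ.
    rewrite -mulrA ler_peMr// /q -expRM_natl -expRD -{1}(expR0 R) ler_expR.
    rewrite mulrN subr_ge0 -ler_pdivlMr//.
    by move: aQ; rewrite truncn_ge_nat// divr_ge0// ltW.
  rewrite -mulr_sumr ler_wpM2l ?mulr_ge0 ?expR_ge0//.
  apply: (@le_trans _ _ (\sum_(a <- words (fun=> Q.+1) n) q ^+ sumn a)).
    rewrite big_filter big_mkcond; apply: ler_sum => a _.
    by case: ifP => // _; rewrite exprn_ge0// ltW.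
  rewrite sum_words_expr lerXn2r ?nnegrE ?invr_ge0 ?subr_ge0 ?(ltW q1)//.
    by apply: sumr_ge0 => j _; rewrite exprn_ge0// ltW.
  rewrite -[leRHS]mul1r ler_pdivlMr ?subr_gt0// mulrC -opprB mulNr.
  rewrite big_mkord -subrX1 opprB gerBl; exact/exprn_ge0/ltW.
have -> : p = eta ^+ n / \prod_(0 <= k < n) lam k.
  by rewrite /p big_split/= prodr_const_nat subn0 prodfV.
set l := (\prod_(_ <= _ < _) _)^-1.
have l0 : 0 <= l by rewrite invr_ge0 prodr_ge0// => k _; exact: ltW.
rewrite expRD expRM_natr [leLHS](_ : _ = (expR s * l) * (eta / (1 - q)) ^+ n); last first.
  by rewrite exprMn; ring.
rewrite [leRHS]mulrAC ler_wpM2l ?mulr_ge0 ?expR_ge0// lerXn2r ?nnegrE ?expR_ge0//.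
  by rewrite divr_ge0 ?subr_ge0 ?(ltW q1)// ltW.
rewrite ler_pdivrMr ?subr_gt0// mulrBr mulr1 /q expRxMexpNx_1.
by rewrite lerBrDr addrC expR_ge1Dx.
Qed.

End independent_words.

(** * Lower bound *)

(** Summation by parts: with nonincreasing weights, a uniform lower bound on the plain partial sums
    passes to the weighted ones. *)
Lemma abel_lower_bound (R : realDomainType) (c y : nat -> R) (A : R) n :
  (forall k, 0 <= c k) -> (forall k, c k.+1 <= c k) -> 0 <= A ->
  (forall m, (m <= n)%N -> - A <= \sum_(0 <= k < m) y k) ->
  - (c 0%N * A) <= \sum_(0 <= k < n) c k * y k.
Proof.
move=> c0 cS A0; case: n => [_|n yA].
  by rewrite big_geq// oppr_le0 mulr_ge0.
(* Strengthened for the induction: the bracket is nonnegative, so replacing [c n] by the smaller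
   [c n.+1] only lowers the bound. *)
apply: (@le_trans _ _ (c n * (\sum_(0 <= k < n.+1) y k + A) - c 0%N * A)).
  by rewrite lerBrDr addNr mulr_ge0// -lerBlDr add0r yA.
elim: n yA => [|n IH] yA; first by rewrite !big_nat1 mulrDr addrK.
rewrite [leRHS]big_nat_recr//= [X in _ * (X + A)]big_nat_recr//=.
have {IH} := IH (fun m mn => yA m (leqW mn)).
have := yA n.+1 (leqW (leqnn _)); have := cS n.
move: (\sum_(0 <= k < n.+1) y k) (\sum_(0 <= k < n.+1) c k * y k) => Y Z.
by move: (c0 n.+1); nra.
Qed.

Section lower.
Context d (T : measurableType d) (R : realType) (P : probability T R).
Variables (F : nat -> nat) (Y : seq nat -> {RV P >-> R}).
Hypothesis indepY : independent_words F Y.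
Hypothesis expY : forall s, exponential_mean1 (Y s).
Hypothesis F_gt0 : forall k, (0 < F k)%N.

(** There are countably many words, so a single null set serves all of them. *)
Lemma exponential_gt0_ae : {ae P, forall t, forall w : seq nat, 0 < Y w t}.
Proof.
have : {ae P, forall t, forall n, if unpickle n is Some w then 0 < Y w t else true}.
  apply: ae_foralln => n; case: (unpickle n) => [w|]; last exact: aeW.
  exists (Y w @^-1` `]-oo, 0]%classic); split.
  - by apply: preimage_measurable; exact: measurable_itv.
  - exact: exponential_le0.
  - by move=> t /= /negP; rewrite -leNgt in_itv.
by apply: filterS => t H w; have := H (pickle w); rewrite pickleK.
Qed.

(** A union bound over the words: with [lam k = e * F k], the product in [chernoff] cancels the
    number of words and leaves [expR (- n)]. With [eta = eps / 2] the total exponent is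
    [- eps * n / 2]. *)
Lemma chernoff_words eps n : 0 < eps < 1 ->
  exists2 D : set T, measurable D /\ (P D <= (expR (- (eps / 2)) ^+ n)%:E)%E &
    forall t w, (forall w, 0 < Y w t) -> w \in words F n ->
      \sum_(0 <= k < n) (expR 1 * (F k)%:R) * Y (take k.+1 w) t < (1 - eps) * n%:R ->
      D t.
Proof.
move=> /andP[e0 e1].
have F0 k : 0 < (F k)%:R :> R by rewrite ltr0n.
pose lam k : R := expR 1 * (F k)%:R.
have lam0 k : 0 < lam k by rewrite mulr_gt0 ?expR_gt0.
pose b : R := expR ((1 - eps) * n%:R + eps / 2 * n%:R) / \prod_(0 <= k < n) lam k.
have /choice[D DP] w : exists D : set T, measurable D /\ (w \in words F n ->
   (P D <= b%:E)%E /\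
    forall t, (forall k, (k < n)%N -> 0 < Y (take k.+1 w) t) ->
      \sum_(0 <= k < n) lam k * Y (take k.+1 w) t < (1 - eps) * n%:R -> D t).
  have [wn|wn] := boolP (w \in words F n); last by exists set0; split.
  have [||D [mD PD] DP] := chernoff indepY expY wn lam0
    (_ : 0 <= (1 - eps) * n%:R) (_ : 0 < eps / 2); last by exists D.
    by rewrite mulr_ge0// subr_ge0 ltW.
  by rewrite divr_gt0.
exists (\big[setU/set0]_(w <- words F n) D w); last first.
  move=> t w Y0 wn Yn; rewrite -bigcup_seq; exists w => //.
  by have [_ /(_ wn)[_]] := DP w; apply.
split; first by apply: bigsetU_measurable => w _; case: (DP w).
apply: le_trans (probability_bigsetU_le _ _ _) _; first by move=> w; case: (DP w).
apply: (@le_trans _ _ (\sum_(w <- words F n) b%:E)%E).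
  by rewrite big_seq [leRHS]big_seq; apply: lee_sum => w wn;
     have [_ /(_ wn)[]] := DP w.
rewrite sumEFin lee_fin big_const_seq count_predT iter_addr_0 size_words.
rewrite /b big_split/= prodr_const_nat subn0 -natr_prod -mulr_natl.
set x := expR (_ + _); rewrite [leLHS](_ : _ = x * (expR 1 ^+ n)^-1); last first.
  by field; rewrite expf_neq0 ?expR_eq0// pnatr_eq0 -lt0n prodn_gt0.
rewrite /x -!expRM_natr -expRN -!expRD ler_expR.
by rewrite -subr_ge0 (_ : _ - _ = 0)//; field.
Qed.

Lemma lower_ae eps : 0 < eps < 1 -> (forall k, (F k <= F k.+1)%N) ->
  {ae P, forall t, exists A : R, forall n w, w \in words F n ->
    (1 - eps) / expR 1 * (\sum_(0 <= k < n) (F k)%:R^-1) - A <=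
    \sum_(0 <= k < n) Y (take k.+1 w) t}.
Proof.
move=> eps01 ndF; have /andP[e0 e1] := eps01.
have /choice[D DP] n : exists D : set T,
    (measurable D /\ (P D <= (expR (- (eps / 2)) ^+ n)%:E)%E) /\
    forall t w, (forall w, 0 < Y w t) -> w \in words F n ->
      \sum_(0 <= k < n) (expR 1 * (F k)%:R) * Y (take k.+1 w) t < (1 - eps) * n%:R ->
      D t.
  by have [D H1 H2] := chernoff_words n eps01; exists D.
have mD n : measurable (D n) by have [[]] := DP n.
have PD n : (P (D n) <= (expR (- (eps / 2)) ^+ n)%:E)%E by have [[]] := DP n.
have q1 : `|expR (- (eps / 2))| < 1 :> R.
  by rewrite ger0_norm ?expR_ge0// expR_lt1 oppr_lt0 divr_gt0.
have : {ae P, forall t, ~ lim_sup_set D t}.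
  exists (lim_sup_set D); split.
  - by apply: bigcap_measurable => // k _; apply: bigcup_measurable.
  - apply: lim_sup_set_cvg0 => //.
    apply: (@le_lt_trans _ _ (\sum_(n <oo) (expR (- (eps / 2)) ^+ n)%:E)%E).
      by apply: lee_nneseries => // n _; exact: PD.
    apply: (@le_lt_trans _ _ (1 * (1 - expR (- (eps / 2)))^-1)%:E); last exact: ltry.
    apply: lime_le; first by apply: is_cvg_nneseries => n _ _; rewrite lee_fin exprn_ge0// expR_ge0.
    apply: nearW => n; rewrite sumEFin lee_fin.
    apply: le_trans (geometric_le_lim n _ _ q1) => //; last exact: expR_gt0.
    by rewrite /series /geometric /=; under [leRHS]eq_bigr do rewrite mul1r.
  - by move=> t /= /contrapT.
apply: filterS2 exponential_gt0_ae => t Y0 Dt.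
have [n0 n0P] : exists n0, forall n, (n0 <= n)%N -> ~ D n t.
  move: Dt; rewrite /lim_sup_set => /existsNP[n0 /not_implyP[_ H]].
  by exists n0 => n n0n Dn; apply: H; exists n.
(* Below level [n0] the weighted sums are only known to be nonnegative, which loses at most this
   amount. *)
pose A : R := (1 - eps) * n0%:R.
have F0 k : 0 < (F k)%:R :> R by rewrite ltr0n.
exists ((expR 1 * (F 0%N)%:R)^-1 * A) => n w wn.
(* The weights are [1 / lam k] and the terms [lam k * Y - (1 - eps)]; their product is the
   difference of the summands in the two sums to be compared. *)
have := @abel_lower_bound _ (fun k => (expR 1 * (F k)%:R)^-1)
  (fun k => (expR 1 * (F k)%:R) * Y (take k.+1 w) t - (1 - eps)) A n.
have H : forall m, (m <= n)%N -> - A <= \sum_(0 <= k < m)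
   ((expR 1 * (F k)%:R) * Y (take k.+1 w) t - (1 - eps)).
  move=> m mn; rewrite sumrB sumr_const_nat subn0 -mulr_natr.
  have [n0m|mn0] := leqP n0 m.
    apply: (@le_trans _ _ 0); first by rewrite oppr_le0 mulr_ge0// subr_ge0 ltW.
    rewrite subr_ge0 leNgt; apply/negP => lt; apply: (n0P _ n0m).
    have [_] := DP m; apply; [exact: Y0|exact: take_words wn|].
    apply: le_lt_trans lt; rewrite big_nat [leRHS]big_nat.
    by apply: ler_sum => k /andP[_ km]; rewrite take_takel.
  have S0 : 0 <= \sum_(0 <= k < m) expR 1 * (F k)%:R * Y (take k.+1 w) t.
    by apply: sumr_ge0 => k _; rewrite !mulr_ge0 ?expR_ge0// ltW.
  have : (1 - eps) * m%:R <= A.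
    by apply: ler_wpM2l; [rewrite subr_ge0 ltW|rewrite ler_nat ltnW].
  by move: S0; lra.
have c0 k : 0 < (expR 1 * (F k)%:R)^-1 :> R by rewrite invr_gt0 mulr_gt0 ?expR_gt0.
move=> /(_ (fun k => ltW (c0 k)) _ _ H) => H'.
have : - ((expR 1 * (F 0)%:R)^-1 * A) <= \sum_(0 <= k < n)
    (Y (take k.+1 w) t - (1 - eps) / expR 1 * (F k)%:R^-1).
  apply: le_trans (H' _ _) _.
  - by move=> k; rewrite lef_pV2 ?posrE ?mulr_gt0 ?expR_gt0// ler_wpM2l ?expR_ge0// ler_nat.
  - by rewrite mulr_ge0// subr_ge0 ltW.
  - apply: ler_sum => k _; rewrite le_eqVlt; apply/orP; left; apply/eqP.
    by field; rewrite expR_eq0 gt_eqF.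
by rewrite sumrB -mulr_sumr; lra.
Qed.

End lower.

(** * Upper bound *)

Lemma fact_expR_le (R : realType) n : (0 < n)%N ->
  n`!%:R * expR n%:R <= expR 1 * n%:R * n%:R ^+ n :> R.
Proof.
elim: n => // -[_ _|n IH _]; first by rewrite expr1 !mulr1 mul1r.
set m := n.+1 in IH *.
have m0 : 0 < m%:R :> R by rewrite ltr0n.
have m1 : 0 < m.+1%:R :> R by rewrite ltr0n.
have e0 := expR_gt0 (1 : R).
have le1 : expR 1 * m%:R ^+ m.+1 <= m.+1%:R ^+ m.+1 :> R.
  have := expR_ge1Dx (- m.+1%:R^-1 : R).
  have -> : 1 - m.+1%:R^-1 = m%:R / m.+1%:R :> R.
    by rewrite -natr1; field; rewrite gt_eqF// natr1.
  move=> le0.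
  have : (m%:R / m.+1%:R) ^+ m.+1 <= expR (- m.+1%:R^-1) ^+ m.+1 :> R.
    by rewrite lerXn2r ?nnegrE ?expR_ge0// divr_ge0 ?ler0n.
  rewrite -expRM_natr mulNr mulVf ?gt_eqF// expRN exprMn exprVn.
  rewrite ler_pdivrMr ?exprn_gt0// mulrC ler_pdivlMr// mulrC.
  exact.
rewrite factS natrM -{2}natr1 expRD.
rewrite (_ : _ * _ = m.+1%:R * expR 1 * (m`!%:R * expR m%:R)); last by ring.
apply: (@le_trans _ _ (m.+1%:R * expR 1 * (expR 1 * m%:R * m%:R ^+ m))).
  by rewrite ler_wpM2l ?mulr_ge0 ?ler0n ?expR_ge0// IH.
rewrite (_ : _ * _ = m.+1%:R * expR 1 * (expR 1 * m%:R ^+ m.+1)); last by rewrite exprS; ring.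
by rewrite [expR 1 * m.+1%:R]mulrC ler_wpM2l// mulr_ge0 ?ler0n// ltW.
Qed.

(** The right-hand side is the mean number of good continuations over one block, with
    [beta = c * L / (L + q)]. Take [q = L * t]: since [L! 'C(L + q, L) >= q ^ L], Stirling bounds
    the mean below by [rho ^ L / (e * L)] with [rho = c * e * t / (t + 1)], and [rho > 1] once [t]
    is large. *)
Lemma block_constants (R : realType) (c : R) : expR (-1) < c ->
  exists L q : nat, (0 < L)%N /\
    2 <= (c * L%:R / (L + q)%:R) ^+ L * 'C(L + q, L)%:R.
Proof.
move=> ec.
have e0 := expR_gt0 (1 : R).
have ce : 1 < c * expR 1 by rewrite -ltr_pdivrMr// div1r -expRN.
pose t := (Num.truncn (c * expR 1 - 1)^-1).+1.
have tP : 1 < (c * expR 1 - 1) * t%:R.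
  rewrite -ltr_pdivrMl ?subr_gt0// mulr1.
  have : 0 <= (c * expR 1 - 1)^-1 by rewrite invr_ge0 subr_ge0 ltW.
  by move=> /truncn_itv/andP[].
pose rho := c * expR 1 * (t%:R / t.+1%:R).
have t0 : 0 < t.+1%:R :> R by rewrite ltr0n.
have rho1 : 1 < rho.
  by rewrite /rho mulrA ltr_pdivlMr// mul1r -natr1; lra.
have lr0 : 0 < ln rho by rewrite ln_gt0.
(* This size gives [(L * ln rho) ^ 2 / 2 >= 2 * e * L], and the left side is at most
   [expR (L * ln rho) = rho ^ L]. *)
pose L := (Num.truncn (4 * expR 1 / ln rho ^+ 2)).+1.
have L0 : 0 < L%:R :> R by rewrite ltr0n.
have LP : 2 * expR 1 * L%:R <= rho ^+ L.
  rewrite -[rho]lnK ?posrE ?(lt_trans _ rho1)// -expRM_natl.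
  apply: le_trans (expR_ge1Dxn 1 _); last by rewrite mulr_ge0// ltW.
  apply: (@le_trans _ _ ((L%:R * ln rho) ^+ 2 / 2)); last by rewrite lerDr.
  have : 4 * expR 1 / ln rho ^+ 2 < L%:R.
    have : 0 <= 4 * expR 1 / ln rho ^+ 2 by rewrite divr_ge0 ?sqr_ge0// mulr_ge0// ltW.
    by move=> /truncn_itv/andP[].
  rewrite ltr_pdivrMr ?exprn_gt0// => H.
  rewrite ler_pdivlMr// exprMn expr2 -mulrA mulrAC.
  by move: H; move: (ln rho ^+ 2) => z H; nra.
exists L, (L * t)%N; split => //.
rewrite -(@ler_pM2r _ (L`!%:R * expR L%:R)) ?mulr_gt0 ?expR_gt0 ?ltr0n ?fact_gt0//.
apply: (@le_trans _ _ (2 * (expR 1 * L%:R * L%:R ^+ L))).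
  by rewrite ler_pM2l// fact_expR_le.
have H : (L * t)%:R ^+ L <= 'C(L + L * t, L)%:R * L`!%:R :> R.
  rewrite -natrX -natrM ler_nat bin_ffact ffact_prod -[X in (_ ^ X)%N]card_ord.
  by rewrite -prod_nat_const; apply: leq_prod => i _; have := ltn_ord i; lia.
rewrite -mulrA; apply: (@le_trans _ _
    ((c * L%:R / (L + L * t)%:R) ^+ L * ((L * t)%:R ^+ L * expR L%:R))).
  have -> : expR L%:R = expR 1 ^+ L :> R by rewrite -expRM_natl mulr1.
  rewrite -!exprMn (_ : c * _ / _ * _ = rho * L%:R); last first.
    rewrite /rho natrD natrM -[in RHS]natr1; field; rewrite ?natr1.
    by rewrite gt_eqF//= gt_eqF// ltr_wpDr// mulr_ge0// ler0n.
  by rewrite exprMn !mulrA ler_wpM2r// exprn_ge0.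
rewrite -[leRHS]mulrA ler_wpM2l ?exprn_ge0 ?divr_ge0 ?mulr_ge0 ?ler0n//.
  by rewrite (le_trans _ (ltW ec))// expR_ge0.
by rewrite mulrA ler_wpM2r// expR_ge0.
Qed.

(** Stars and bars: the blocks are all vectors of [L] cell indices with sum at most [q], so
    restricting the entries to ['I_q.+1] loses nothing. *)
Lemma card_blocks L q : exists Bl : seq (seq nat),
  [/\ uniq Bl, size Bl = 'C(L + q, L) &
      forall b, b \in Bl -> size b = L /\ (sumn b <= q)%N].
Proof.
pose G := [set t : L.-tuple 'I_q.+1 | (\sum_(i <- t) i <= q)%N]%SET.
exists [seq map val (tval t) | t <- enum G]; split.
- rewrite map_inj_uniq ?enum_uniq// => s t /(inj_map val_inj) st.
  exact: val_inj.
- by rewrite size_map -cardE card_partial_ord_partitions.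
- move=> b /mapP[t]; rewrite mem_enum inE => tq ->.
  by rewrite size_map size_tuple; split => //; rewrite sumnE big_map.
Qed.

(** [m] is the level at which two lines of descent part; beyond it their edges are distinct, hence
    independent. *)
Lemma common_prefix (T : eqType) n (w w' : seq T) : size w = n -> size w' = n ->
  exists m, [/\ (m <= n)%N, take m w = take m w' &
    forall k, (m <= k < n)%N -> take k.+1 w <> take k.+1 w'].
Proof.
elim: n w w' => [|n IH] [|x w] [|x' w'] //=.
  by move=> _ _; exists 0%N; split=> // k; rewrite andbF.
move=> [sw] [sw']; have [->|xx'] := eqVneq x x'.
  have [m [mn mw mP]] := IH _ _ sw sw'; exists m.+1; split => //=.
    by rewrite mw.
  by case=> // k kmn [/(mP k)]; apply.
exists 0%N; split; rewrite ?take0// => k _ [xx]; by rewrite xx eqxx in xx'.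
Qed.

(** * Pairs of lines of descent, and cells of equal probability *)

Section second_moment.
Context d (T : measurableType d) (R : realType) (P : probability T R).
Variables (F : nat -> nat) (Y : seq nat -> {RV P >-> R}).
Hypothesis indepY : independent_words F Y.
Hypothesis expY : forall s, exponential_mean1 (Y s).

Lemma probability_path_event2 w w' n m m' A A' (p : nat -> R) :
  w \in words F n -> w' \in words F n ->
  (forall k, measurable (A k)) -> (forall k, measurable (A' k)) ->
  (forall k s, (m <= k < n)%N -> P (Y s @^-1` A k) = (p k)%:E) ->
  (forall k s, (m' <= k < n)%N -> P (Y s @^-1` A' k) = (p k)%:E) ->
  (forall k, (m' <= k < n)%N -> take k.+1 w <> take k.+1 w') ->
  P (path_event Y w m n A `&` path_event Y w' m' n A') =
  (\prod_(m <= k < n) p k * \prod_(m' <= k < n) p k)%:E.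
Proof.
move=> wF wF' mA mA' Ap Ap' ww'.
have sw := size_words_mem wF; have sw' := size_words_mem wF'.
have st k : (k < n)%N -> size (take k.+1 w) = k.+1 by move=> kn; rewrite size_takel ?sw.
have st' k : (k < n)%N -> size (take k.+1 w') = k.+1 by move=> kn; rewrite size_takel ?sw'.
(* Independence takes one family of sets indexed by words, so [B] merges [A] and [A'] according to
   which line a prefix belongs to. *)
pose B s := if s == take (size s) w then A (size s).-1 else A' (size s).-1.
have -> : path_event Y w m n A `&` path_event Y w' m' n A' =
    \big[setI/setT]_(s <- [seq take k.+1 w | k <- index_iota m n] ++
                         [seq take k.+1 w' | k <- index_iota m' n])
      (Y s @^-1` B s).
  rewrite big_cat !big_map; congr setI; apply: eq_big_nat => k /andP[mk kn].
    by rewrite /B st// eqxx.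
  rewrite /B st'// ifN//; apply/eqP => /esym; apply: ww'.
  by rewrite mk.
rewrite indepY//.
- rewrite big_cat !big_map EFinM -!prodEFin; congr (_ * _)%E.
    rewrite big_seq [RHS]big_seq; apply: eq_bigr => k.
    rewrite mem_index_iota => kmn; have /andP[_ kn] := kmn.
    by rewrite /B st// eqxx Ap.
  rewrite big_seq [RHS]big_seq; apply: eq_bigr => k.
  rewrite mem_index_iota => kmn; have /andP[_ kn] := kmn.
  rewrite /B st'// ifN ?Ap'//; apply/eqP => /esym; exact: ww'.
- rewrite cat_uniq !map_inj_in_uniq ?iota_uniq ?andbT.
  + apply/hasPn => _ /mapP[k + ->]; rewrite mem_index_iota => kmn.
    apply/negP => /mapP[l]; rewrite mem_index_iota => /andP[_ ln] eqkl.
    have /andP[_ kn] := kmn; have := congr1 size eqkl; rewrite st// st'// => -[kl].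
    by apply: (ww' k kmn); rewrite eqkl kl.
  + move=> k l; rewrite !mem_index_iota => /andP[_ kn] /andP[_ ln] /(congr1 size).
    by rewrite !st'// => -[].
  + move=> k l; rewrite !mem_index_iota => /andP[_ kn] /andP[_ ln] /(congr1 size).
    by rewrite !st// => -[].
- move=> s; rewrite mem_cat => /orP[] /mapP[k]; rewrite mem_index_iota => /andP[_ kn] ->.
    by rewrite st// (@take_words F n).
  by rewrite st'// (@take_words F n).
- by move=> s; rewrite /B; case: ifP.
Qed.

(* The image of this cell under x |-> 1 - exp(- x) is ]a u, (a + 1) u], so every
   cell has probability u. *)
Definition cell (u : R) (a : nat) : set R :=
  `]- ln (1 - a%:R * u), - ln (1 - a.+1%:R * u)]%classic.

Lemma measurable_cell u a : measurable (cell u a).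
Proof. exact: measurable_itv. Qed.

Lemma cell_expR u a x : 0 <= u -> a.+1%:R * u < 1 -> cell u a x ->
  a%:R * u < 1 - expR (- x) <= a.+1%:R * u.
Proof.
move=> u0 au; have au' : a%:R * u < 1.
  by apply: le_lt_trans au; rewrite ler_wpM2r// ler_nat.
rewrite /cell /= in_itv/= => /andP[ax xa]; apply/andP; split.
  rewrite ltrBrDr -ltrBrDl -[ltRHS]lnK ?posrE ?subr_gt0// ltr_expR.
  by rewrite ltrNl.
rewrite lerBlDr -lerBlDl -[leLHS]lnK ?posrE ?subr_gt0// ler_expR.
by rewrite lerNr.
Qed.

Lemma cell_disjoint u a b x : 0 < u -> a.+1%:R * u < 1 -> b.+1%:R * u < 1 ->
  cell u a x -> cell u b x -> a = b.
Proof.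
move=> u0 au bu /(cell_expR (ltW u0) au)/andP[a1 a2] /(cell_expR (ltW u0) bu)/andP[b1 b2].
apply/eqP; rewrite eqn_leq -[(a <= b)%N]ltnS -[(b <= a)%N]ltnS.
rewrite -(ltr_nat R) -(ltr_nat R b) -(ltr_pM2r u0) -(ltr_pM2r u0 b%:R).
by rewrite (lt_le_trans a1 b2) (lt_le_trans b1 a2).
Qed.

Lemma probability_cell u a s : 0 <= u -> a.+1%:R * u < 1 ->
  P (Y s @^-1` cell u a) = u%:E.
Proof.
move=> u0 au; have au' : a%:R * u <= a.+1%:R * u by rewrite ler_wpM2r// ler_nat.
have au'' := le_lt_trans au' au.
rewrite /cell exponential_itv//.
- rewrite !opprK !lnK ?posrE ?subr_gt0//; congr EFin.
  by rewrite -natr1; ring.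
- rewrite oppr_ge0 ln_le0// gerBl mulr_ge0//.
- by rewrite lerN2 ler_ln ?posrE ?subr_gt0// lerB.
Qed.

End second_moment.

Lemma nth_le_sumn s k : (nth 0%N s k <= sumn s)%N.
Proof.
elim: s k => [|x s IH] [|k] //=; first exact: leq_addr.
by rewrite (leq_trans (IH k))// leq_addl.
Qed.

Lemma sum_count (R : pzSemiRingType) (I : Type) (s : seq I) (p : pred I) :
  \sum_(i <- s) (p i)%:R = (count p s)%:R :> R.
Proof. by rewrite -sum1_count natr_sum [RHS]big_mkcond; apply: eq_bigr => i _; case: (p i). Qed.

(** Grouped into runs of [L] terms, run [i] contributes the sum over [r] divided by
    [(beta ^ L * C) ^ i >= 2 ^ i]; the geometric series adds up to at most 2. *)
Lemma block_sum_le (R : realFieldType) (beta : R) (C L n : nat) :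
  (0 < L)%N -> 0 < beta -> 2 <= beta ^+ L * C%:R ->
  \sum_(0 <= j < n * L) (beta ^+ j)^-1 * (C%:R ^+ (j %/ L))^-1 <=
  2 * \sum_(0 <= r < L) (beta ^+ r)^-1.
Proof.
move=> L0 b0 bC; set kappa := \sum_(0 <= r < L) _.
pose g j : R := (beta ^+ j)^-1 * (C%:R ^+ (j %/ L))^-1.
rewrite (eq_bigr g)//.
have kappa0 : 0 <= kappa.
  by apply: sumr_ge0 => r _; rewrite invr_ge0 exprn_ge0// ltW.
have x0 : 0 < beta ^+ L * C%:R by apply: lt_le_trans bC.
have step i : \sum_(i * L <= j < i.+1 * L) g j = (beta ^+ L * C%:R)^-1 ^+ i * kappa.
  rewrite mulSnr -{1}[(i * L)%N]add0n big_addn addKn mulr_sumr.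
  apply: eq_big_nat => r /andP[_ rL]; rewrite /g addnC divnMDl// divn_small// addn0.
  by rewrite exprD mulnC exprM exprVn exprMn !invfM; ring.
have le2 i : (beta ^+ L * C%:R)^-1 ^+ i <= 2^-1 ^+ i.
  by rewrite lerXn2r ?nnegrE ?invr_ge0 ?(ltW x0)// lef_pV2 ?posrE.
apply: (@le_trans _ _ ((2 - 2 * 2^-1 ^+ n) * kappa)); last first.
  by rewrite ler_wpM2r// gerBl mulr_ge0// exprn_ge0// invr_ge0.
elim: n => [|n IH]; first by rewrite big_geq// expr0 mulr1 subrr mul0r.
rewrite (big_cat_nat (n := (n * L)%N)) ?leq_mul2r ?leqnSn ?orbT//= step.
have := le2 n; rewrite exprS => le2n.
have : (beta ^+ L * C%:R)^-1 ^+ n * kappa <= 2^-1 ^+ n * kappa by rewrite ler_wpM2r.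
by move: IH; move: (2^-1 ^+ n) => z; lra.
Qed.

(** * Second moment of the number of good lines of descent *)

Section blocks.
Context d (T : measurableType d) (R : realType) (P : probability T R).
Variables (F : nat -> nat) (Y : seq nat -> {RV P >-> R}).
Hypothesis indepY : independent_words F Y.
Hypothesis expY : forall s, exponential_mean1 (Y s).
Hypothesis F_gt0 : forall k, (0 < F k)%N.
Variables (n0 L q : nat) (Bl : seq (seq nat)) (beta : R).
Hypothesis L_gt0 : (0 < L)%N.
Hypothesis Bl_uniq : uniq Bl.
Hypothesis BlP : forall b, b \in Bl -> size b = L /\ (sumn b <= q)%N.
Hypothesis beta_gt0 : 0 < beta.

Let u k : R := beta / (F k)%:R.
Hypothesis u_small : forall k, (n0 <= k)%N -> q.+1%:R * u k < 1.

(** The cell index prescribed for edge [k]: letter [i] of [bs] is the position in [Bl] of the [i]-th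
    block after level [n0]. Out of range, the defaults still give a value at most [q]. *)
Definition label (bs : seq nat) k :=
  nth 0%N (nth [::] Bl (nth 0%N bs ((k - n0) %/ L))) ((k - n0) %% L).

Let C := size Bl.

(** Indexed by a line of descent together with a code that fixes the cell of every edge, so that all
    these events have the same probability. *)
Definition good_event (B : nat) (x : seq nat * seq nat) : set T :=
  path_event Y x.1 n0 (n0 + B * L) (fun k => cell (u k) (label x.2 k)).

Let u_gt0 k : 0 < u k. Proof. by rewrite divr_gt0// ltr0n. Qed.

Lemma label_le bs k : (label bs k <= q)%N.
Proof.
rewrite /label; set c := nth 0%N bs _; case: (ltnP c (size Bl)) => cB; last first.
  by rewrite [nth [::] _ _]nth_default// nth_nil.
by apply: leq_trans (nth_le_sumn _ _) _; have [] := BlP (mem_nth [::] cB).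
Qed.

Let label_u bs k : (n0 <= k)%N -> (label bs k).+1%:R * u k < 1.
Proof.
move=> n0k; apply: le_lt_trans (u_small n0k).
by rewrite ler_wpM2r ?ler_nat ?ltnS ?label_le// ltW.
Qed.

Lemma measurable_good_event B x : measurable (good_event B x).
Proof. by apply: measurable_path_event => k; exact: measurable_cell. Qed.

Let U B := \prod_(n0 <= k < n0 + B * L) u k.

Lemma probability_good_event B w bs : w \in words F (n0 + B * L) ->
  P (good_event B (w, bs)) = (U B)%:E.
Proof.
move=> wF; apply: (probability_path_event indepY wF) => [k|k s /andP[n0k _]].
  exact: measurable_cell.
by apply: probability_cell => //; [exact: ltW|exact: label_u].
Qed.

(* Let m be the level at which the two lines of descent split. If both events
   occur then, the cells being disjoint, the block codes agree on all the blocks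
   that end at or before level m. *)
Lemma good_event2_le B x y : let n := (n0 + B * L)%N in
  x.1 \in words F n -> y.1 \in words F n ->
  x.2 \in words (fun=> C) B -> y.2 \in words (fun=> C) B ->
  (P (good_event B x `&` good_event B y) <=
   (U B * U B + \sum_(n0 <= m < n.+1)
     ((take m y.1 == take m x.1)%:R *
      (take ((m - n0) %/ L) y.2 == take ((m - n0) %/ L) x.2)%:R *
      (U B * \prod_(m <= k < n) u k)))%:E)%E.
Proof.
case: x y => [w bs] [w' bs'] /= wF wF' bsC bsC'.
set n := (n0 + B * L)%N in wF wF' *.
have U0 : 0 <= U B by apply: prodr_ge0 => k _; exact: ltW.
have term0 m : 0 <= (take m w' == take m w)%:R *
      (take ((m - n0) %/ L) bs' == take ((m - n0) %/ L) bs)%:R *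
      (U B * \prod_(m <= k < n) u k).
  by rewrite !mulr_ge0// prodr_ge0// => k _; exact: ltW.
have [m [mn mw mP]] := common_prefix (size_words_mem wF) (size_words_mem wF').
(* Forgetting the constraints on the second line before level [m'] enlarges the event and leaves
   only distinct edges. *)
have split_le m' : (n0 <= m')%N -> (m <= m')%N ->
    (P (good_event B (w, bs) `&` good_event B (w', bs')) <=
     (U B * \prod_(m' <= k < n) u k)%:E)%E.
  move=> n0m' mm'.
  pose A' k := cell (u k) (label bs' k).
  apply: (@le_trans _ _ (P (good_event B (w, bs) `&` path_event Y w' m' n A'))).
    apply: le_measure; rewrite ?inE.
    - by apply: measurableI; exact: measurable_good_event.
    - apply: measurableI; first exact: measurable_good_event.
      by apply: measurable_path_event => // k; exact: measurable_cell.
    - apply: setIS => t /path_eventP H; apply/path_eventP => k /andP[mk kn].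
      by apply: H; rewrite (leq_trans n0m' mk).
  rewrite (@probability_path_event2 _ _ _ _ _ _ indepY _ _ n _ _ _ _ u)//.
  - by move=> k; exact: measurable_cell.
  - by move=> k; exact: measurable_cell.
  - move=> k s /andP[n0k _].
    by apply: probability_cell => //; [exact: ltW|exact: label_u].
  - move=> k s /andP[m'k _].
    apply: probability_cell => //; [exact: ltW|].
    by apply: label_u; exact: leq_trans m'k.
  - by move=> k /andP[m'k kn]; apply: mP; rewrite (leq_trans mm').
(* Lines that part before level [n0] share no constrained edge; they account for the term
   [U B * U B]. *)
have [n0m|mn0] := leqP n0 m; last first.
  apply: le_trans (split_le n0 (leqnn _) (ltnW mn0)) _.
  by rewrite lee_fin lerDl sumr_ge0.
have [eqbs|neqbs] := eqVneq (take ((m - n0) %/ L) bs') (take ((m - n0) %/ L) bs).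
  apply: le_trans (split_le m n0m (leqnn _)) _.
  rewrite lee_fin [X in _ <= _ + X](bigD1_seq m) ?iota_uniq ?mem_index_iota ?n0m//=.
  rewrite -mw eqbs !eqxx !mul1r addrCA lerDl addr_ge0 ?mulr_ge0//.
  by apply: sumr_ge0 => k _; exact: term0.
rewrite (_ : _ `&` _ = set0) ?measure0.
  by rewrite lee_fin addr_ge0 ?mulr_ge0// sumr_ge0.
rewrite -subset0 => t [/path_eventP H /path_eventP H'].
have [sbs bsP] := wordsP _ _ _ bsC; have [sbs' bsP'] := wordsP _ _ _ bsC'.
have iB : ((m - n0) %/ L <= B)%N.
  by rewrite -(mulnK B L_gt0) leq_div2r// leq_subLR.
have sbl b : b \in Bl -> size b = L by case/BlP.
have [j [ji bj]] : exists j, (j < (m - n0) %/ L)%N /\ nth 0%N bs' j != nth 0%N bs j.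
  apply: contra_notP (negP neqbs) => nj; apply/eqP.
  have st x : size x = B -> size (take ((m - n0) %/ L) x) = ((m - n0) %/ L)%N.
    by move=> sx; rewrite size_takel ?sx.
  apply: (@eq_from_nth _ 0%N); rewrite st// ?st// => j ji; rewrite !nth_take//.
  by apply/eqP/negPn/negP => bj; apply: nj; exists j.
have jB := leq_trans ji iB.
set b := nth [::] Bl (nth 0%N bs j); set b' := nth [::] Bl (nth 0%N bs' j).
have bBl : b \in Bl by rewrite mem_nth// bsP.
have bBl' : b' \in Bl by rewrite mem_nth// bsP'.
have bb' : b' != b by rewrite nth_uniq// ?bsP ?bsP'.
have [r [rL br]] : exists r, (r < L)%N /\ nth 0%N b' r != nth 0%N b r.
  apply: contra_notP (negP bb') => nr; apply/eqP.
  apply: (@eq_from_nth _ 0%N); rewrite ?(sbl _ bBl) ?(sbl _ bBl')// => r rL.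
  by apply/eqP/negPn/negP => br; apply: nr; exists r.
(* A common edge, at position [r] of block [j], for which the two codes prescribe different
   cells. *)
pose k := (n0 + (j * L + r))%N.
have km : (k < m)%N.
  rewrite -ltn_subRL; apply: (@leq_trans ((m - n0) %/ L * L)); last exact: leq_trunc_div.
  apply: (@leq_trans (j.+1 * L)); last by rewrite leq_mul2r ji orbT.
  by rewrite mulSnr ltn_add2l.
have n0k : (n0 <= k)%N by rewrite leq_addr.
have kn : (n0 <= k < n)%N by rewrite n0k (leq_trans km).
have lk c : label c k = nth 0%N (nth [::] Bl (nth 0%N c j)) r.
  by rewrite /label /k addKn divnMDl// divn_small// addn0 modnMDl modn_small.
have := cell_disjoint (u_gt0 k) (label_u _ n0k) (label_u _ n0k) (H' _ kn).
rewrite -(take_takel _ km) -mw take_takel// => /(_ _ (H _ kn)); rewrite !lk => eqb.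
by rewrite /b' /b eqb eqxx in br.
Qed.

Definition candidates B := [seq (w, bs) | w <- words F (n0 + B * L),
                                         bs <- words (fun=> C) B].

(** Let [D] be the number of vertices of level [n0]. The mean number of good pairs is
    [D * (C * beta ^ L) ^ B], and grouping pairs by split level bounds the variance over the squared
    mean by [1 / D] times the sum in [block_sum_le], uniformly in [B]. *)
Lemma probability_no_good B : 2 <= beta ^+ L * C%:R ->
  (P (~` \big[setU/set0]_(x <- candidates B) good_event B x) <=
   (2 * (\sum_(0 <= r < L) (beta ^+ r)^-1) / \prod_(0 <= k < n0) (F k)%:R)%:E)%E.
Proof.
move=> bC2; set n := (n0 + B * L)%N; set N := ~` _.
have n0n : (n0 <= n)%N by exact: leq_addr.
have F0 k : 0 < (F k)%:R :> R by rewrite ltr0n.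
have C0 : 0 < C%:R :> R.
  rewrite ltr0n lt0n; apply/negP => /eqP C0; move: bC2.
  by rewrite C0 mulr0 leNgt ltr0n.
have U0 : 0 < U B by apply: prodr_gt0.
pose s := candidates B.
have ss : (size s)%:R = (\prod_(0 <= k < n) (F k)%:R) * C%:R ^+ B :> R.
  rewrite size_allpairs !size_words natrM !natr_prod -/n; congr (_ * _).
  by rewrite prodr_const_nat subn0.
have inS x : x \in s -> x.1 \in words F n /\ x.2 \in words (fun=> C) B.
  by case/allpairsP => [[w bs] /= [wF bsC ->]].
pose c m := U B * \prod_(m <= k < n) u k.
pose i m := ((m - n0) %/ L)%N.
have iB m : (m <= n)%N -> (i m <= B)%N.
  by move=> mn; rewrite -(mulnK B L_gt0) leq_div2r// leq_subLR.
(* Contribution of the candidates sharing the ancestor at level [m]: descendants of that ancestor,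
   times codes with the same first [i m] letters, times the probability bound. A pair is counted at
   each common ancestor from level [n0] on, which only overcounts. *)
pose v1 := \sum_(n0 <= m < n.+1) (\prod_(m <= k < n) (F k)%:R) * C%:R ^+ (B - i m) * c m.
have inner x : x \in s ->
   (\sum_(y <- s) P (good_event B x `&` good_event B y) <=
     ((size s)%:R * (U B * U B) + v1)%:E)%E.
  move=> xs; have [x1 x2] := inS _ xs.
  apply: (@le_trans _ _ (\sum_(y <- s) (U B * U B + \sum_(n0 <= m < n.+1)
     ((take m y.1 == take m x.1)%:R * (take (i m) y.2 == take (i m) x.2)%:R * c m))%:E)%E).
    rewrite big_seq [leRHS]big_seq; apply: lee_sum => y ys.
    by have [y1 y2] := inS _ ys; exact: good_event2_le.
  rewrite sumEFin lee_fin big_split/= big_const_seq count_predT iter_addr_0.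
  rewrite mulr_natl lerD2l exchange_big/= /v1 le_eqVlt; apply/orP; left; apply/eqP.
  apply: eq_big_nat => m /andP[n0m]; rewrite ltnS => mn.
  rewrite -mulr_suml; congr (_ * _).
  rewrite big_allpairs_dep/=.
  under eq_bigr do rewrite -mulr_sumr sum_count.
  rewrite -mulr_suml sum_count; congr (_ * _).
    by rewrite count_words_take ?natr_prod//; exact: take_words x1.
  rewrite count_words_take ?iB//; last by apply: take_words x2; exact: iB.
  by rewrite natr_prod prodr_const_nat.
have Pg : {in s, forall x, P (good_event B x) = (U B)%:E}.
  by move=> [w bs] /inS[] /= *; exact: probability_good_event.
have := @second_moment _ _ _ P _ s _ (U B) ((size s)%:R * v1)
  (measurable_good_event B) Pg.
have EE : (\sum_(x <- s) \sum_(y <- s) P (good_event B x `&` good_event B y) <=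
    (((size s)%:R * U B) ^+ 2 + (size s)%:R * v1)%:E)%E.
  apply: (@le_trans _ _ (\sum_(x <- s) ((size s)%:R * (U B * U B) + v1)%:E)%E).
    by rewrite big_seq [leRHS]big_seq; apply: lee_sum => x xs; exact: inner.
  rewrite sumEFin lee_fin big_const_seq count_predT iter_addr_0 -mulr_natl.
  by rewrite le_eqVlt; apply/orP; left; apply/eqP; ring.
have mN : measurable N.
  by apply: measurableC; apply: bigsetU_measurable => x _; exact: measurable_good_event.
move=> /(_ EE); rewrite -/N -(fineK (fin_num_measure P _ mN)) -EFinM !lee_fin.
set pr := fine _ => prle.
have D0 : 0 < \prod_(0 <= k < n0) (F k)%:R :> R by exact: prodr_gt0.
have Fu m : (n0 <= m <= n)%N ->
   (\prod_(m <= k < n) (F k)%:R) * \prod_(m <= k < n) u k = beta ^+ (n - m).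
  move=> _; rewrite -big_split/= -prodr_const_nat; apply: eq_bigr => k _.
  by rewrite mulrC divfK// gt_eqF.
have NU : (size s)%:R * U B = (\prod_(0 <= k < n0) (F k)%:R) * (C%:R ^+ B * beta ^+ (B * L)).
  have := Fu n0; rewrite leqnn n0n addKn => /(_ isT) <-.
  by rewrite ss (big_cat_nat (n := n0))//= /U -/n; ring.
have v1E : v1 = U B * (C%:R ^+ B * beta ^+ (B * L) *
    \sum_(0 <= j < (B * L).+1) (beta ^+ j)^-1 * (C%:R ^+ (j %/ L))^-1).
  rewrite /v1 -{1}[n0]add0n big_addn subSn// addKn !mulr_sumr.
  apply: eq_big_nat => j; rewrite ltnS => /andP[_ jBL].
  have := Fu (j + n0)%N; rewrite leq_addl addnC leq_add2l => /(_ jBL) FU.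
  rewrite /c (_ : _ * (U B * _) = U B * (C%:R ^+ (B - i (n0 + j)%N) *
    ((\prod_(n0 + j <= k < n) (F k)%:R) * \prod_(n0 + j <= k < n) u k))); last by ring.
  rewrite FU; congr (_ * _).
  rewrite /i addKn subnDl; have jB : (j %/ L <= B)%N.
    by rewrite -(mulnK B L_gt0) leq_div2r.
  by rewrite !expfB_cond ?gt_eqF//; ring.
have bL0 : 0 < C%:R ^+ B * beta ^+ (B * L) by rewrite mulr_gt0 ?exprn_gt0.
have NU0 : 0 < (size s)%:R * U B by rewrite NU mulr_gt0.
rewrite ler_pdivlMr// -(ler_pM2r bL0) -mulrA -NU -(ler_pM2r NU0) -mulrA -expr2.
apply: le_trans prle _; rewrite v1E mulrA [leRHS]mulrC ler_pM2l//.
(* The [B * L + 1] terms are completed to [B + 1] full runs of length [L]. *)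
rewrite mulrC ler_pM2r//; apply: le_trans (@block_sum_le _ _ C L B.+1 _ _ bC2) => //.
rewrite [leRHS](big_cat_nat (n := (B * L).+1))//=; last first.
  by rewrite mulSn -addn1 addnC leq_add2r.
by rewrite lerDl sumr_ge0// => j _; rewrite mulr_ge0// invr_ge0 exprn_ge0// ltW.
Qed.

End blocks.

(** With [z = (a + 1) * u], the right end of the cell is [- ln (1 - z) <= z / (1 - z)], and
    [z <= theta]. *)
Lemma cell_le (R : realType) (u theta x : R) a : 0 <= u -> theta < 1 ->
  a.+1%:R * u <= theta -> cell u a x -> x <= a.+1%:R * u / (1 - theta).
Proof.
move=> u0 th1 ath /(cell_expR u0 (le_lt_trans ath th1))/andP[_].
set z := a.+1%:R * u in ath *; move=> xz.
have z0 : 0 <= z by rewrite mulr_ge0.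
have z1 : z < 1 := le_lt_trans ath th1.
have : expR x <= (1 - z)^-1.
  rewrite -[x]opprK expRN lef_pV2 ?posrE ?expR_gt0 ?subr_gt0//.
  by rewrite lerBlDr addrC -lerBlDr.
move=> ex; have := expR_ge1Dx x => ex1.
apply: (@le_trans _ _ (z / (1 - z))).
  have -> : z / (1 - z) = (1 - z)^-1 - 1 by field; rewrite gt_eqF// subr_gt0.
  by lra.
by rewrite ler_wpM2l// lef_pV2 ?posrE ?subr_gt0// lerB.
Qed.

(** * Passage time along a good line of descent *)

Section block_cost.
Variables (R : realType) (F : nat -> nat) (n0 L q : nat) (Bl : seq (seq nat)).
Variables (beta theta : R).
Hypothesis F_gt0 : forall k, (0 < F k)%N.
Hypothesis F_nd : forall k l, (k <= l)%N -> (F k <= F l)%N.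
Hypothesis L_gt0 : (0 < L)%N.
Hypothesis BlP : forall b, b \in Bl -> size b = L /\ (sumn b <= q)%N.
Hypothesis beta_gt0 : 0 < beta.
Hypothesis theta_lt1 : theta < 1.
Let u k : R := beta / (F k)%:R.
Hypothesis u_small : forall k, (n0 <= k)%N -> q.+1%:R * u k <= theta.

(** As [u] is nonincreasing, the first level of the block dominates, and the values [label + 1] over
    the block add up to [L] plus the sum of its cell indices. *)
Lemma one_block_cost bs (y : nat -> R) B b : bs \in words (fun=> size Bl) B ->
  (forall k, (n0 <= k < n0 + B * L)%N -> cell (u k) (label n0 L Bl bs k) (y k)) ->
  (b < B)%N ->
  \sum_(n0 + b * L <= k < n0 + b.+1 * L) y k <=
  beta * (L + q)%:R / (1 - theta) / (F (n0 + b * L)%N)%:R.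
Proof.
move=> bsB good bB; have [sbs bsP] := wordsP _ _ _ bsB.
have u0 k : 0 < u k by rewrite divr_gt0// ltr0n.
set bl := nth [::] Bl (nth 0%N bs b).
have /BlP[sbl sumbl] : bl \in Bl by rewrite mem_nth// bsP.
apply: (@le_trans _ _ (\sum_(n0 + b * L <= k < n0 + b.+1 * L)
   (label n0 L Bl bs k).+1%:R * (u (n0 + b * L) / (1 - theta)))).
  apply: ler_sum_nat => k /andP[bk kb].
  have n0k : (n0 <= k)%N by apply: leq_trans bk; rewrite leq_addr.
  apply: le_trans (cell_le (ltW (u0 k)) theta_lt1 _ (good k _)) _.
  - apply: le_trans (u_small n0k); rewrite ler_wpM2r ?ler_nat ?ltnS ?(ltW (u0 _))//.
    exact: label_le BlP _ _.
  - by rewrite n0k (leq_trans kb)// leq_add2l leq_mul2r bB orbT.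
  - rewrite mulrA ler_wpM2r ?invr_ge0 ?subr_ge0 ?(ltW theta_lt1)//.
    rewrite ler_wpM2l// /u ler_pM2l// lef_pV2 ?posrE ?ltr0n// ler_nat.
    exact: F_nd.
rewrite -mulr_suml -natr_sum.
have -> : (\sum_(n0 + b * L <= k < n0 + b.+1 * L) (label n0 L Bl bs k).+1 = L + sumn bl)%N.
  rewrite mulSnr addnA -{1}[(n0 + b * L)%N]add0n big_addn addKn.
  rewrite (eq_bigr (fun r => 1 + label n0 L Bl bs (r + (n0 + b * L))))%N; last first.
    by move=> r; rewrite add1n.
  rewrite big_split/= sum_nat_const_nat subn0 muln1 sumnE [in RHS](big_nth 0%N) sbl.
  congr addn; apply: eq_big_nat => r /andP[_ rL].
  by rewrite /label addnCA addKn addnC divnMDl// divn_small// addn0 modnMDl modn_small.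
apply: (@le_trans _ _ ((L + q)%:R * (u (n0 + b * L) / (1 - theta)))).
  rewrite ler_wpM2r ?ler_nat ?leq_add2l// divr_ge0 ?(ltW (u0 _))//.
  by rewrite subr_ge0 ltW.
by rewrite le_eqVlt; apply/orP; left; apply/eqP; rewrite /u; ring.
Qed.

(** Since [F] is nondecreasing, [L / F] at the start of a block is at most the sum of [1 / F] over
    the preceding block. The first block has no predecessor and is paid for by the term [L]. *)
Lemma blocks_cost bs (y : nat -> R) B b : bs \in words (fun=> size Bl) B ->
  (forall k, (n0 <= k < n0 + B * L)%N -> cell (u k) (label n0 L Bl bs k) (y k)) ->
  (b < B)%N ->
  \sum_(n0 <= k < n0 + b.+1 * L) y k <=
  beta * (L + q)%:R / L%:R / (1 - theta) *
    (L%:R + \sum_(n0 <= k < n0 + b * L) (F k)%:R^-1).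
Proof.
move=> bsB good; have L0 : 0 < L%:R :> R by rewrite ltr0n.
have F0 k : 0 < (F k)%:R :> R by rewrite ltr0n.
set c := beta * (L + q)%:R / L%:R / (1 - theta).
have c0 : 0 <= c.
  rewrite divr_ge0 ?subr_ge0 ?(ltW theta_lt1)// divr_ge0 ?(ltW L0)//.
  by rewrite mulr_ge0 ?ler0n ?ltW.
have one b' : (b' < B)%N -> \sum_(n0 + b' * L <= k < n0 + b'.+1 * L) y k <=
    c * (L%:R / (F (n0 + b' * L)%N)%:R).
  move=> bB; apply: le_trans (one_block_cost bsB good bB) _.
  rewrite le_eqVlt; apply/orP; left; apply/eqP; rewrite /c; field.
  by rewrite !gt_eqF// subr_gt0.
elim: b => [|b IH] bB.
  have := one _ bB; rewrite mul0n addn0 mul1n => /le_trans; apply.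
  rewrite big_geq// addr0 ler_wpM2l// ler_pdivrMr// ler_peMr ?(ltW L0)//.
  by rewrite ler1n.
have le_block i : (n0 + i * L <= n0 + i.+1 * L)%N.
  by rewrite leq_add2l leq_mul2r leqnSn orbT.
rewrite (big_cat_nat (leq_addr _ _) (le_block b.+1)).
rewrite [X in _ * (_ + X)](big_cat_nat (leq_addr _ _) (le_block b)) /=.
rewrite addrA mulrDr lerD ?IH ?(ltnW bB)//.
apply: le_trans (one _ bB) _; rewrite ler_wpM2l//.
apply: (@le_trans _ _ (\sum_(n0 + b * L <= k < n0 + b.+1 * L) (F (n0 + b.+1 * L)%N)%:R^-1)).
  by rewrite sumr_const_nat mulSnr addnA addKn -[leRHS]mulr_natl.
apply: ler_sum_nat => k /andP[_ kb].
by rewrite lef_pV2 ?posrE ?F0// ler_nat F_nd// ltnW.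
Qed.

End block_cost.

(** * Almost sure upper bound for unbounded growth *)

Section upper.
Context d (T : measurableType d) (R : realType) (P : probability T R).
Variables (F : nat -> nat) (Y : seq nat -> {RV P >-> R}).
Hypothesis indepY : independent_words F Y.
Hypothesis expY : forall s, exponential_mean1 (Y s).
Hypothesis F_gt0 : forall k, (0 < F k)%N.
Hypothesis F_nd : forall k l, (k <= l)%N -> (F k <= F l)%N.
Hypothesis F_unbounded : forall K, exists k, (K < F k)%N.

Lemma upper_ae (c : R) : expR (-1) < c ->
  {ae P, forall t, exists A : R, forall n, exists2 w, w \in words F n &
    \sum_(0 <= k < n) Y (take k.+1 w) t <=
    c * (\sum_(0 <= k < n) (F k)%:R^-1) + A}.
Proof.
move=> ec; pose c' := (c + expR (-1)) / 2.
have ec' : expR (-1) < c' by rewrite /c'; lra.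
have c'c : c' < c by rewrite /c'; lra.
have e0 := expR_gt0 (-1 : R).
have c'0 : 0 < c' := lt_trans e0 ec'.
have c0 : 0 < c := lt_trans e0 ec.
have [L [q [L_gt0 bC]]] := block_constants ec'.
have [Bl [Bl_uniq sBl BlP]] := card_blocks L q.
set beta := c' * _ / _ in bC.
have L0 : 0 < L%:R :> R by rewrite ltr0n.
have Lq0 : 0 < (L + q)%:R :> R by rewrite ltr0n addn_gt0 L_gt0.
have beta0 : 0 < beta by exact: divr_gt0 (mulr_gt0 c'0 L0) Lq0.
rewrite -sBl in bC.
(* Chosen so that [c' / (1 - theta) = c], while [beta * (L + q) / L = c']: the gap between [c'] and
   [c] absorbs the nonlinearity of the cells. *)
pose theta := 1 - c' / c.
have theta1 : theta < 1 by rewrite /theta gtrBl divr_gt0.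
have theta0 : 0 < theta by rewrite subr_gt0 ltr_pdivrMr// mul1r.
have F0 k : 0 < (F k)%:R :> R by rewrite ltr0n.
(* Level [n0 j] has at least [j] vertices, which makes the failure probability [O(1 / j)], and from
   there on the cells in use stay below [theta]. Both come from the unboundedness of [F]. *)
have /choice[n0 n0P] j : exists n0 : nat, (j <= \prod_(0 <= k < n0) F k)%N /\
    q.+1%:R * (beta / (F n0)%:R) <= theta.
  have [k kP] := F_unbounded (maxn j (Num.truncn (q.+1%:R * beta / theta))).
  move: kP; rewrite gtn_max => /andP[jk tk].
  exists k.+1; split.
    rewrite big_nat_recr//= (leq_trans (ltnW jk))// leq_pmull//.
    by apply: prodn_gt0.
  rewrite mulrA ler_pdivrMr// [leRHS]mulrC -ler_pdivrMr// ltW//.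
  have /truncn_itv/andP[_ /lt_le_trans] : 0 <= q.+1%:R * beta / theta.
    by rewrite divr_ge0 ?(ltW theta0)// mulr_ge0// ltW.
  by apply; rewrite ler_nat (leq_trans tk)// F_nd.
pose N j B : set T := ~` \big[setU/set0]_(x <- candidates F (n0 j) L Bl B)
  good_event F Y (n0 j) L Bl beta B x.
have u_small j k : (n0 j <= k)%N -> q.+1%:R * (beta / (F k)%:R) <= theta.
  move=> jk; have [_] := n0P j; apply: le_trans.
  by rewrite ler_wpM2l// ler_pM2l// lef_pV2 ?posrE// ler_nat F_nd.
have u_lt1 j k : (n0 j <= k)%N -> q.+1%:R * (beta / (F k)%:R) < 1.
  by move=> jk; apply: le_lt_trans theta1; exact: u_small jk.
have mN j B : measurable (N j B).
  apply: measurableC; apply: bigsetU_measurable => x _; exact: measurable_good_event.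
pose kappa : R := 2 * (\sum_(0 <= r < L) (beta ^+ r)^-1).
have kappa0 : 0 <= kappa.
  by rewrite mulr_ge0// sumr_ge0// => r _; rewrite invr_ge0 exprn_ge0// ltW.
have PN j B : (P (N j.+1 B) <= (kappa / j.+1%:R)%:E)%E.
  apply: le_trans (@probability_no_good _ _ _ _ _ _ indepY expY F_gt0 _ _ _ _ _
    L_gt0 Bl_uniq BlP beta0 (u_lt1 j.+1) B bC) _.
  rewrite lee_fin ler_wpM2l//.
  have [jn _] := n0P j.+1; rewrite -natr_prod lef_pV2 ?posrE ?ltr0n ?ler_nat//.
  by rewrite (leq_trans _ jn).
(* Truncating a good line of [B + 1] blocks gives one of [B] blocks, so continuity from below
   carries the bound, uniform in [B], over to the union. *)
have ndN j : nondecreasing_seq (N j).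
  apply/nondecreasing_seqP => B; apply/subsetPset => t; apply: contra_not.
  rewrite -!bigcup_seq => -[[w bs] /allpairsP[[w1 bs1] /= [wF bsC [-> ->]]]].
  move=> /path_eventP good.
  have le1 : (n0 j + B * L <= n0 j + B.+1 * L)%N by rewrite leq_add2l leq_mul2r leqnSn orbT.
  exists (take (n0 j + B * L) w1, take B bs1) => /=.
    apply/allpairsP; exists (take (n0 j + B * L) w1, take B bs1) => /=.
    split => //; [exact: take_words wF|exact: (take_words (leqnSn B) bsC)].
  apply/path_eventP => k /andP[nk kn] /=.
  rewrite take_takel//; have := good k; rewrite nk (leq_trans kn le1) => /(_ isT).
  rewrite /label nth_take// ltn_divLR// ltn_subLR//; exact: leq_trans kn _.
have PUN j : (P (\bigcup_B N j.+1 B) <= (kappa / j.+1%:R)%:E)%E.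
  have mUN : measurable (\bigcup_B N j.+1 B) by exact: bigcup_measurable.
  have H := nondecreasing_cvg_mu (mN j.+1) mUN (ndN j.+1) (mu := P).
  rewrite -(cvg_lim _ H)//; apply: lime_le; first by apply/cvg_ex; eexists; exact: H.
  by apply: nearW => B; exact: PN.
have : {ae P, forall t, ~ (\bigcap_j \bigcup_B N j.+1 B) t}.
  exists (\bigcap_j \bigcup_B N j.+1 B); split.
  - by apply: bigcap_measurable => // j _; exact: bigcup_measurable.
  - have mI : measurable (\bigcap_j \bigcup_B N j.+1 B).
      by apply: bigcap_measurable => // j _; exact: bigcup_measurable.
    have PI j : (P (\bigcap_j \bigcup_B N j.+1 B) <= (kappa / j.+1%:R)%:E)%E.
      apply: le_trans (PUN j); apply: le_measure; rewrite ?inE//.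
        exact: bigcup_measurable.
      exact: bigcap_inf.
    apply/eqP; rewrite eq_le measure_ge0 andbT leNgt.
    rewrite -(fineK (fin_num_measure P _ mI)) lte_fin; apply/negP => p0.
    have /truncn_itv/andP[_] := divr_ge0 kappa0 (ltW p0).
    rewrite ltr_pdivrMr// mulrC -ltr_pdivrMr// ltNge.
    by rewrite -lee_fin fineK ?PI// fin_num_measure.
  - by move=> t /= /contrapT.
apply: filterS2 (exponential_gt0_ae expY) => t Y0 /existsNP[j].
move=> /not_implyP[_ noN]; set m := n0 j.+1.
(* The sum over all words of length [m] dominates the cost of the first [m] edges of any line;
   [c * L] pays for the first block. *)
exists (\sum_(v <- words F m) \sum_(0 <= k < m) Y (take k.+1 v) t + c * L%:R) => n.
(* [b + 1] blocks reach level [n], while the [b] blocks in the bound of [blocks_cost] end by level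
   [n]. For [n <= m], truncated subtraction gives [b = 0]. *)
pose b := ((n - m) %/ L)%N.
have : ~ N j.+1 b.+1 t by apply: contra_not noN => Nb; exists b.+1.
rewrite /N => /contrapT; rewrite -bigcup_seq => -[[w bs] /allpairsP[[w1 bs1] /= [wF bsC [-> ->]]]].
move=> /path_eventP good.
have nm : (n <= m + b.+1 * L)%N.
  by rewrite -leq_subLR ltnW// -ltn_divLR.
exists (take n w1); first exact: take_words wF.
have sum_take i : \sum_(0 <= k < i) Y (take k.+1 (take i w1)) t =
    \sum_(0 <= k < i) Y (take k.+1 w1) t.
  by apply: eq_big_nat => k /andP[_ ki]; rewrite take_takel.
have mbL : (m <= m + b.+1 * L)%N by rewrite leq_addr.
apply: (@le_trans _ _ (\sum_(0 <= k < m + b.+1 * L) Y (take k.+1 w1) t)).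
  rewrite [leRHS](big_cat_nat (n := n))//=.
  rewrite sum_take lerDl; apply: sumr_ge0 => k _; exact: ltW.
rewrite (big_cat_nat (n := m))//=.
have H1 : \sum_(0 <= k < m) Y (take k.+1 w1) t <=
    \sum_(v <- words F m) \sum_(0 <= k < m) Y (take k.+1 v) t.
  rewrite (bigD1_seq (take m w1)) ?words_uniq//=; last exact: take_words wF.
  rewrite sum_take lerDl; apply: sumr_ge0 => v _; apply: sumr_ge0 => k _; exact: ltW.
have {}bsC : bs1 \in words (fun=> size Bl) b.+1 := bsC.
have := @blocks_cost _ _ _ _ _ _ _ _ F_gt0 F_nd L_gt0 BlP beta0 theta1 (u_small j.+1)
  _ (fun k => Y (take k.+1 w1) t) _ _ bsC good (ltnSn b).
rewrite -/m.
have -> : beta * (L + q)%:R / L%:R / (1 - theta) = c.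
  rewrite /beta /theta; field.
  by rewrite subKr -natrD !gt_eqF.
have H2 : \sum_(m <= k < m + b * L) (F k)%:R^-1 <= \sum_(0 <= k < n) (F k)%:R^-1 :> R.
  have Fi0 k : 0 <= (F k)%:R^-1 :> R by rewrite invr_ge0 ltW.
  have [b0|b0] := posnP b.
    by rewrite b0 mul0n addn0 big_geq// sumr_ge0.
  have mn : (m <= n)%N.
    rewrite leqNgt; apply/negP => nm'; move: b0; rewrite /b.
    by rewrite (eqP (ltnW nm' : (n - m == 0)%N)) div0n.
  have mbn : (m + b * L <= n)%N by rewrite -leq_subRL// leq_trunc_div.
  rewrite [leRHS](big_cat_nat (leq0n m) mn) [X in _ <= _ + X](big_cat_nat (leq_addr _ _) mbn) /=.
  by rewrite addrCA lerDl addr_ge0// sumr_ge0.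
move=> H3; have : c * \sum_(m <= k < m + b * L) (F k)%:R^-1 <=
   c * \sum_(0 <= k < n) (F k)%:R^-1 by rewrite ler_pM2l.
by lra.
Qed.

End upper.

(** * Minimal passage times *)

Lemma seq_argmin (I : eqType) (R : realDomainType) (g : I -> R) (s : seq I) :
  s != [::] -> exists2 i, i \in s & {in s, forall j, g i <= g j}.
Proof.
elim: s => // i [|j s] IH _.
  by exists i; rewrite ?mem_head// => k; rewrite inE => /eqP ->.
have [k ks kP] := IH isT.
have [ik|ki] := lerP (g i) (g k).
  exists i; rewrite ?mem_head// => l; rewrite inE => /predU1P[->//|/kP].
  exact: le_trans.
exists k; first by rewrite inE ks orbT.
by move=> l; rewrite inE => /predU1P[->|/kP//]; exact: ltW.
Qed.

(** * Partial sums of the reciprocals of the growth function *)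

Section harmonic.
Context (R : realType) (f : nat -> nat).
Hypothesis f_gt0 : forall n, (1 <= n)%N -> (1 <= f n)%N.

Let f0 n : (1 <= n)%N -> (0 <= ((f n)%:R^-1 : R)%:E)%E.
Proof. by rewrite lee_fin invr_ge0. Qed.

Lemma divergent_series :
  (\sum_(1 <= n <oo) ((f n)%:R^-1 : R)%:E = +oo)%E ->
  forall K : R, exists N, K < \sum_(1 <= n < N.+1) (f n)%:R^-1.
Proof.
move=> sumoo K; apply: contrapT => /forallNP H.
suff : (\sum_(1 <= n <oo) ((f n)%:R^-1 : R)%:E <= K%:E)%E by rewrite sumoo leye_eq.
apply: lime_le; first by apply: is_cvg_nneseries => n n1 _; exact: f0.
near=> N; rewrite sumEFin lee_fin leNgt; apply/negP.
by rewrite -(@prednK N); [exact: H|near: N; exists 1%N].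
Unshelve. all: by end_near. Qed.

Lemma convergent_series :
  (\sum_(1 <= n <oo) ((f n)%:R^-1 : R)%:E < +oo)%E ->
  exists K : R, forall N, \sum_(1 <= n < N.+1) (f n)%:R^-1 <= K.
Proof.
move=> sumoo; have fin : (\sum_(1 <= n <oo) ((f n)%:R^-1 : R)%:E)%E \is a fin_num.
  by rewrite ge0_fin_numE// nneseries_ge0// => n n1 _; exact: f0.
exists (fine (\sum_(1 <= n <oo) ((f n)%:R^-1 : R)%:E)%E) => N.
rewrite -lee_fin fineK// -sumEFin; apply: nneseries_lim_ge => n n1 _; exact: f0.
Qed.

(** If [f] stayed below [k], every term would be at least [1 / k]. This makes the upper bound
    available when the sum is finite. *)
Lemma convergent_unbounded (K : R) :
  (forall N, \sum_(1 <= n < N.+1) (f n)%:R^-1 <= K) ->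
  forall k : nat, exists n, (1 <= n)%N /\ (k < f n)%N.
Proof.
move=> HK k; apply: contrapT => /forallNP H.
have fk n : (1 <= n)%N -> (f n <= k)%N.
  by move=> n1; rewrite leqNgt; apply/negP => kf; exact: (H n).
have k0 : (0 < k)%N by apply: leq_trans (fk 1%N isT); exact: f_gt0.
pose N := Num.truncn (K * k%:R).
have K0 : 0 <= K by apply: le_trans (HK 0%N); rewrite big_geq.
have /truncn_itv/andP[_] : 0 <= K * k%:R by rewrite mulr_ge0.
rewrite -/N -ltr_pdivlMr ?ltr0n// ltNge => /negP; apply.
apply: le_trans (HK N.+1).
apply: (@le_trans _ _ (\sum_(1 <= n < N.+2) k%:R^-1)).
  rewrite sumr_const_nat subSS subn0 -[leRHS]mulr_natl.
  by rewrite ler_wpM2r ?invr_ge0.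
apply: ler_sum_nat => n /andP[n1 _].
by rewrite lef_pV2 ?posrE ?ltr0n ?f_gt0// ler_nat fk.
Qed.

End harmonic.

(** * From words back to the vertices of the tree *)

Section transfer.
Context (V : choiceType) (e : rel V) (rho : V) (f : nat -> nat)
  (d : measure_display) (T : measurableType d) (R : realType)
  (P : probability T R) (X : V -> {RV P >-> R}).
Hypothesis f_gt0 : forall n, (1 <= n)%N -> (1 <= f n)%N.
Variable vert : seq nat -> V.
Let F := f \o S.
Hypothesis vert_path : forall n s, s \in words F n -> dist e rho (vert s) = n /\
  tree_path e rho (vert s) = mkseq (fun k => vert (take k.+1 s)) n.
Hypothesis vert_inj : forall n s s', s \in words F n -> s' \in words F n ->
  vert s = vert s' -> s = s'.
Hypothesis vert_surj : forall n v, dist e rho v = n ->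
  exists2 s, s \in words F n & vert s = v.

Lemma independent_vert : mutually_independent X -> independent_words F (X \o vert).
Proof.
move=> indep_X ss A ss_uniq ssF mA.
(* [vert_inj] compares words of one length; the distance from the root recovers the length. *)
have inj s s' : s \in words F (size s) -> s' \in words F (size s') ->
    vert s = vert s' -> s = s'.
  move=> sF sF' eqv; apply: (vert_inj sF _ eqv).
  have [<- _] := vert_path sF; have [ds' _] := vert_path sF'.
  by rewrite eqv ds'.
pose word v := xget [::] [set s | s \in words F (size s) /\ vert s = v].
have wordK : {in ss, forall s, word (vert s) = s}.
  move=> s /ssF sF; rewrite /word; case: xgetP => [s' _ [sF' eqv]|/(_ s)].
    exact: inj.
  by move=> H; exfalso; apply: H.
have /= := @indep_X (map vert ss) (A \o word).
rewrite map_inj_in_uniq => [|s s' /ssF sF /ssF sF']; last exact: inj.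
move=> /(_ ss_uniq (fun v => mA (word v))); rewrite !big_map.
rewrite big_seq (eq_bigr (fun s => X (vert s) @^-1` A s)); last first.
  by move=> s sS; rewrite wordK.
rewrite -big_seq => ->; rewrite big_seq [RHS]big_seq; apply: eq_bigr => s sS.
by rewrite wordK.
Qed.

Lemma passage_time_vert n w t : w \in words F n ->
  passage_time e rho X (vert w) t = \sum_(0 <= k < n) X (vert (take k.+1 w)) t.
Proof.
by move=> wF; have [_ pw] := vert_path wF; rewrite /passage_time pw big_map /index_iota subn0.
Qed.

Let S w t := \sum_(0 <= k < size w) X (vert (take k.+1 w)) t.

Lemma min_passage_timeP n t : exists2 w, w \in words F n &
  min_passage_time e rho X n t = S w t /\ {in words F n, forall w', S w t <= S w' t}.
Proof.
have [|w wF wP] := @seq_argmin _ _ (S^~ t) (words F n).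
  by apply: words_neq0 => k; exact: f_gt0.
exists w => //; split => //.
have Sw : passage_time e rho X (vert w) t = S w t.
  by rewrite (passage_time_vert _ wF) /S (size_words_mem wF).
set E := [set passage_time e rho X v t | v in [set v | dist e rho v = n]].
have Ew : E (S w t) by exists (vert w); [exact: (vert_path wF).1|].
have lbE : lbound E (S w t).
  move=> _ [v /= /vert_surj[w' wF' <-] <-].
  by rewrite (passage_time_vert _ wF'); have := wP _ wF'; rewrite {2}/S (size_words_mem wF').
apply/eqP; rewrite eq_le; apply/andP; split.
  by apply: ge_inf => //; exists (S w t).
by apply: lb_le_inf => //; exists (S w t).
Qed.

Lemma measurable_min_passage_time n K :
  measurable [set t | `|min_passage_time e rho X n t| <= K].
Proof.
have mS w : measurable_fun setT (S w) by exact: measurable_sum.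
have -> : [set t | `|min_passage_time e rho X n t| <= K] =
   (\big[setU/set0]_(w <- words F n) (S w @^-1` `]-oo, K])) `&`
   (\big[setI/setT]_(w <- words F n) (S w @^-1` `[- K, +oo[)).
  rewrite -bigcup_seq -bigcap_seq; apply/seteqP; split => t /=.
    have [w wF [-> wP]] := min_passage_timeP n t; rewrite ler_norml => /andP[Kw wK].
    split; first by exists w => //=; rewrite in_itv.
    by move=> w' /= /wP; rewrite in_itv/= andbT; exact: le_trans.
  move=> [[w /= wF]]; rewrite in_itv/= => wK H.
  have [w' wF' [-> wP]] := min_passage_timeP n t; rewrite ler_norml.
  rewrite (le_trans (wP _ wF) wK) andbT.
  by have := H _ wF'; rewrite /= in_itv/= andbT.
apply: measurableI.
  by apply: bigsetU_measurable => w _; rewrite -[_ @^-1` _]setTI; exact: mS.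
by apply: bigsetI_measurable => w _; rewrite -[_ @^-1` _]setTI; exact: mS.
Qed.

(** Integer bounds make the explosion a countable union of countable intersections, hence
    measurable. *)
Lemma explosionP t : explosion e rho X t <->
  exists K : nat, forall n, `|min_passage_time e rho X n t| <= K%:R.
Proof.
have PF : ProperFilter (globally [set: nat]).
  by apply: (@globally_properfilter _ _ 0%N).
split=> [|[K HK]].
  move=> /ex_bound[K HK]; exists (Num.truncn `|K|).+1 => n.
  apply: le_trans (HK n I) _; apply: le_trans (ler_norm K) _.
  by have /truncn_itv/andP[_ /ltW] := normr_ge0 K.
by apply/ex_bound; exists K%:R => n _; exact: HK.
Qed.

Lemma measurable_explosion : measurable (explosion e rho X).
Proof.
have -> : explosion e rho X =
    \bigcup_K \bigcap_n [set t | `|min_passage_time e rho X n t| <= K%:R].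
  apply/seteqP; split => t.
    by move=> /explosionP[K HK]; exists K => // n _; exact: HK.
  by move=> [K _ HK]; apply/explosionP; exists K => n; exact: HK.
apply: bigcupT_measurable => K; apply: bigcapT_measurable => n.
exact: measurable_min_passage_time.
Qed.

End transfer.

(** * The explosion criterion and the almost sure limit *)

Theorem theorem3 (V : choiceType) (e : rel V) (rho : V) (f : nat -> nat)
  (d : measure_display) (T : measurableType d) (R : realType)
  (P : probability T R) (X : V -> {RV P >-> R})
  (tree_e : is_tree e)
  (infinite_V : infinite_set [set: V])
  (f_gt0 : forall n, (1 <= n)%N -> (1 <= f n)%N)
  (f_nondecreasing : forall m n, (1 <= m)%N -> (m <= n)%N -> (f m <= f n)%N)
  (symm_e : spherically_symmetric e rho f)
  (indep_X : mutually_independent X)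
  (exp_X : forall v, exponential_mean1 (X v)) :
  [/\ (\sum_(1 <= n <oo) ((f n)%:R^-1 : R)%:E = +oo)%E ->
        P (explosion e rho X) = 0%E,
      (\sum_(1 <= n <oo) ((f n)%:R^-1 : R)%:E < +oo)%E ->
        P (explosion e rho X) = 1%E
    & (\sum_(1 <= n <oo) ((f n)%:R^-1 : R)%:E = +oo)%E ->
      (forall K : nat, exists n, (1 <= n)%N /\ (K < f n)%N) ->
      {ae P, forall t,
        (fun N => min_passage_time e rho X N t /
                  \sum_(1 <= n < N.+1) (f n)%:R^-1) @ \oo --> expR (-1)}].
Proof.
have [vert [vert_path vert_inj vert_surj]] := ulam_harris tree_e symm_e.
pose F := f \o S.
pose M N t := min_passage_time e rho X N t.
pose H N : R := \sum_(1 <= n < N.+1) (f n)%:R^-1.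
have HE N : \sum_(0 <= k < N) (F k)%:R^-1 = H N by rewrite /H big_add1.
have H_nd m n : (m <= n)%N -> H m <= H n.
  move=> mn; rewrite /H [leRHS](big_cat_nat (n := m.+1))//= lerDl.
  by rewrite sumr_ge0// => k _; rewrite invr_ge0.
have indepY := independent_vert vert_path vert_inj indep_X.
have expY s : exponential_mean1 ((X \o vert) s) by exact: exp_X.
have F_gt0 k : (0 < F k)%N by exact: f_gt0.
have F_nd k l : (k <= l)%N -> (F k <= F l)%N by move=> kl; exact: f_nondecreasing.
have MP := min_passage_timeP X f_gt0 vert_path vert_surj.
have lowerM eps : 0 < eps < 1 ->
    {ae P, forall t, exists A, forall N, (1 - eps) * expR (-1) * H N - A <= M N t}.
  move=> eps01; have := lower_ae indepY expY F_gt0 eps01 (fun k => F_nd _ _ (leqnSn k)).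
  apply: filterS => t [A HA]; exists A => N.
  have [w wF [Mw _]] := MP N t.
  rewrite expRN -HE /M Mw (size_words_mem wF); exact: HA.
have upperM c : (forall K : nat, exists n, (1 <= n)%N /\ (K < f n)%N) -> expR (-1) < c ->
    {ae P, forall t, exists A, forall N, M N t <= c * H N + A}.
  move=> f_unb ec; have F_unb K : exists k, (K < F k)%N.
    by have [[|n] [n1 Kn]] := f_unb K; [|exists n].
  have := upper_ae indepY expY F_gt0 F_nd F_unb ec.
  apply: filterS => t [A HA]; exists A => N.
  have [w wF] := HA N; rewrite HE; apply: le_trans.
  have [w' _ [Mw H']] := MP N t; rewrite /M Mw; apply: le_trans (H' _ wF) _.
  by rewrite (size_words_mem wF).
have mExp := measurable_explosion X f_gt0 vert_path vert_surj.
split.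
- move=> sumoo; apply: measure_negligible => //.
  have : {ae P, forall t, ~ explosion e rho X t}.
    (* Any fixed [eps] would do: a positive multiple of a divergent sum, minus a constant, is
       unbounded. *)
    have : 0 < (2^-1 : R) < 1 by lra.
    move=> /lowerM; apply: filterS => t [A HA] /explosionP[K HK].
    have c0 : 0 < (1 - 2^-1) * expR (-1) :> R by rewrite mulr_gt0 ?expR_gt0//; lra.
    have [N] := divergent_series sumoo ((K%:R + A) / ((1 - 2^-1) * expR (-1))).
    rewrite ltr_pdivrMr// => HN.
    have := le_trans (HA N) (le_trans (ler_norm _) (HK N)).
    by rewrite leNgt => /negP; apply; rewrite ltrBrDr mulrC.
  apply: negligibleS => t /= Et; exact.
- move=> sumoo; have [K HK] := convergent_series sumoo.
  have f_unb := convergent_unbounded f_gt0 HK.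
  suff PE : P (~` explosion e rho X) = 0%E.
    by rewrite -[X in P X]setCK probability_setC ?PE ?sube0//; exact: measurableC.
  apply: measure_negligible; first exact: measurableC.
  (* Any constant above [1 / e] would do; 1 gives [M N t <= K + A]. *)
  have /(upperM _ f_unb) : expR (-1) < 1 :> R by rewrite expR_lt1; lra.
  apply: filterS2 (exponential_gt0_ae expY) => t Y0 [A HA].
  apply/explosionP; exists (Num.truncn `|K + A|).+1 => N.
  have M0 : 0 <= M N t.
    have [w wF [Mw _]] := MP N t; rewrite /M Mw; apply: sumr_ge0 => k _; exact: (ltW (Y0 _)).
  rewrite ger0_norm//; apply: le_trans (HA N) _.
  have /truncn_itv/andP[_ /ltW] := normr_ge0 (K + A); apply: le_trans.
  apply: le_trans (ler_norm _); rewrite mul1r lerD2r; exact: HK.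
- move=> sumoo f_unb.
  (* Countably many slacks, so one null set suffices; [j.+2] keeps the lower slack strictly between
     0 and 1. *)
  have : {ae P, forall t, forall j, (exists A, forall N,
      (1 - j.+2%:R^-1) * expR (-1) * H N - A <= M N t) /\
      (exists A, forall N, M N t <= (expR (-1) + j.+1%:R^-1) * H N + A)}.
    apply: ae_foralln => j.
    have e01 : 0 < (j.+2%:R^-1 : R) < 1 by rewrite invr_gt0 ltr0n/= invf_lt1 ?ltr1n ?ltr0n.
    have ec : expR (-1) < expR (-1) + j.+1%:R^-1 :> R by rewrite ltrDl invr_gt0 ltr0n.
    by apply: filterS2 (lowerM _ e01) (upperM _ f_unb ec).
  apply: filterS => t HM.
  apply/cvgrPdist_le => eps eps0.
  have [j je] : exists j : nat, j.+1%:R^-1 <= eps / 2.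
    have /truncn_itv/andP[_ tj] : 0 <= (eps / 2)^-1 by rewrite invr_ge0 divr_ge0// ltW.
    exists (Num.truncn (eps / 2)^-1).
    by rewrite -[leRHS]invrK lef_pV2 ?posrE ?invr_gt0 ?divr_gt0 ?ltr0n// ltW.
  have [[A HA] [A' HA']] := HM j.
  (* Half of [eps] covers the slack in the constant; for large [N] the other half, times [H N],
     exceeds the additive constants. *)
  have [N0 HN0] := divergent_series sumoo ((`|A| + `|A'| + 1) / (eps / 2)).
  near=> N.
  have HN : (`|A| + `|A'| + 1) / (eps / 2) < H N.
    apply: lt_le_trans HN0 _; apply: H_nd; near: N; exact: nbhs_infty_ge.
  have H0 : 0 < H N.
    by apply: le_lt_trans HN; rewrite divr_ge0 ?addr_ge0// ltW// divr_gt0.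
  move: HN; rewrite ltr_pdivrMr ?divr_gt0// => HN.
  rewrite -[X in `|X - _|](mulfK (lt0r_neq0 H0)) -mulrBl normrM normfV (gtr0_norm H0).
  rewrite ler_pdivrMr// ler_norml.
  have jH : j.+1%:R^-1 * H N <= eps / 2 * H N by rewrite ler_pM2r.
  have jH' : j.+2%:R^-1 * H N <= j.+1%:R^-1 * H N.
    by rewrite ler_pM2r// lef_pV2 ?posrE ?ltr0n// ler_nat.
  have e1 : expR (-1) <= 1 :> R by rewrite expR_le1; lra.
  have j0 : 0 <= j.+2%:R^-1 * H N by rewrite mulr_ge0 ?invr_ge0// ltW.
  have jH'' : expR (-1) * (j.+2%:R^-1 * H N) <= j.+2%:R^-1 * H N.
    by rewrite ler_piMl.
  have := HA N; have := HA' N; have := ler_norm A; have := ler_norm A'.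
  have := normr_ge0 A; have := normr_ge0 A'.
  rewrite -/(M N t); move: (M N t) (H N) (j.+1%:R^-1) (j.+2%:R^-1) HN jH jH' j0 jH''.
  by move=> m h y z *; apply/andP; split; lra.
Unshelve. all: by end_near.
Qed.
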